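(* Let $\alpha$ and $\beta=(\beta_1,\dots,\beta_s,\dots,\beta_k)$ be partitions of $n$, for some $1\leq s<k$. Let $p$ be a prime. If $p \mid \deg\bigl(\chi^{\alpha^{(s)}_{\vec{a}}(\beta_1,\dots,\beta_s)}\bigr)$ for all $\vec{a}\in I^\alpha(\beta_1,\dots,\beta_s)$, and $(\beta_{s+1},\dots,\beta_k)\vdash m$ (with $1<m$) is a $p$-vanishing partition, then $\chi^\alpha(\beta)=0$.
   Context: A partition is written with weakly decreasing positive parts. For a partition $\alpha$ of $n$, $\chi^\alpha$ is the irreducible complex character of $S_n$ labeled by $\alpha$, and $\chi^\alpha(\beta)$ is its value on the class of cycle type $\beta$; $\deg(\chi^\alpha)=\chi^\alpha(1^n)$. For a node $(i,j)$ of the Young diagram $[\alpha]$, the hook $H^\alpha_{i,j}$ consists of the nodes $(i,j')$ of $[\alpha]$ with $j'\ge j$ and $(i',j)$ with $i'\ge i$; its number of nodes is the hook length $h^\alpha_{i,j}$. The rim $R^\alpha_{i,j}$ is the set of nodes $(l,k)$ of $[\alpha]$ with $l\ge i$, $k\ge j$ and $(l+1,k+1)\notin[\alpha]$. ''Removing the hook at node $(i,j)$'' means passing from $[\alpha]$ to the Young diagram $[\alpha]\setminus R^\alpha_{i,j}$; the corresponding partition has size $n-h^\alpha_{i,j}$. For positive integers $\beta_1,\dots,\beta_s$, the process $P^\alpha(\beta_1,\dots,\beta_s)$ is: remove a hook of length $\beta_1$ from $[\alpha]$ at a node $a_1=(i_1,j_1)$ of $[\alpha]$ with hook length $\beta_1$,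 then remove from the resulting diagram a hook of length $\beta_2$ at a node $a_2=(i_2,j_2)$ of that diagram with hook length $\beta_2$, and so on up to the $s$-th step. $I^\alpha(\beta_1,\dots,\beta_s)$ is the set of all sequences $\vec{a}=(a_1,\dots,a_s)$ of pairs of positive integers for which this process can be carried out, and $\alpha^{(s)}_{\vec{a}}(\beta_1,\dots,\beta_s)$ is the partition obtained at the end of the process along $\vec{a}$. A partition $\gamma$ of $m$ is $p$-vanishing if every irreducible character of $S_m$ whose degree is divisible by $p$ takes the value $0$ on the conjugacy class of cycle type $\gamma$. *)

(* Defs.v *)
From mathcomp Require Import all_boot all_order all_algebra.
From mathcomp Require Import all_fingroup all_solvable all_field all_character.

Set Implicit Arguments.
Unset Strict Implicit.
Unset Printing Implicit Defensive.

Import GroupScope GRing.Theory.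

Definition is_partition (n : nat) (a : seq nat) : bool :=
  [&& sorted geq a, 0 \notin a & sumn a == n].

Definition conj_partition (a : seq nat) : seq nat :=
  [seq count (fun r => j < r) a | j <- iota 0 (head 0 a)].

(* Nodes are numbered from 0: (i, j) stands for the node usually written
   (i + 1, j + 1). *)
Definition diagram (a : seq nat) : seq (nat * nat) :=
  [seq (i, j) | i <- iota 0 (size a), j <- iota 0 (nth 0 a i)].

Definition hook (a : seq nat) (x : nat * nat) : seq (nat * nat) :=
  [seq y <- diagram a | [&& y.1 == x.1 & x.2 <= y.2]
                     || [&& y.2 == x.2 & x.1 <= y.1]].

Definition hook_length (a : seq nat) (x : nat * nat) : nat := size (hook a x).

Definition rim (a : seq nat) (x : nat * nat) : seq (nat * nat) :=
  [seq y <- diagram a |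
    [&& x.1 <= y.1, x.2 <= y.2 & (y.1.+1, y.2.+1) \notin diagram a]].

(* The nonzero row lengths of diagram a minus rim a x. *)
Definition remove_hook (a : seq nat) (x : nat * nat) : seq nat :=
  [seq r <- [seq count (fun y => (y.1 == i) && (y \notin rim a x)) (diagram a)
            | i <- iota 0 (size a)] | 0 < r].

(* removal_seq a b xs says that xs belongs to the set I^a(b). *)
Fixpoint removal_seq (a b : seq nat) (xs : seq (nat * nat)) : bool :=
  match b, xs with
  | [::], [::] => true
  | r :: b', x :: xs' =>
      [&& x \in diagram a, hook_length a x == r
        & removal_seq (remove_hook a x) b' xs']
  | _, _ => false
  end.

Definition removal_result (a : seq nat) (xs : seq (nat * nat)) : seq nat :=
  foldl remove_hook a xs.

Definition cycle_type (n : nat) (g : 'S_n) : seq nat :=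
  sort geq [seq #|X| | X : {set 'I_n} <- enum (porbits g)].

(* The stabiliser of the ordered set partition of {0, ..., n - 1} into
   consecutive blocks of sizes a_1, a_2, ...; reshape_index a i is the index of
   the block containing i. *)
Definition young_subgroup (n : nat) (a : seq nat) : {set 'S_n} :=
  [set g : 'S_n | [forall i, reshape_index a (g i) == reshape_index a i]].

Fact young_subgroup_group_set (n : nat) (a : seq nat) :
  group_set (young_subgroup n a).
Proof.
apply/group_setP; split=> [|g h].
  by rewrite inE; apply/forallP=> i; rewrite perm1.
rewrite !inE => /forallP Hg /forallP Hh; apply/forallP=> i.
by rewrite permM (eqP (Hh _)) (eqP (Hg _)).
Qed.

Canonical young_subgroup_group (n : nat) (a : seq nat) :=
  Group (young_subgroup_group_set n a).

Local Open Scope ring_scope.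

Fact sign_mx_repr (n : nat) :
  mx_repr [set: 'S_n] (fun g => ((-1) ^+ odd_perm g)%:M : 'M[algC]_1).
Proof.
split=> [|g h _ _]; first by rewrite odd_perm1.
by rewrite odd_permM signr_addb scalar_mxM.
Qed.

Definition sign_char (n : nat) : 'CF([set: 'S_n]) :=
  cfRepr (MxRepresentation (sign_mx_repr n)).

(* The label of an irreducible character of S_n, as in James and Kerber: for a
   partition a of n with conjugate a', the trivial character of S_a and the
   sign character of S_a', both induced to S_n, have exactly one irreducible
   constituent in common, and that constituent is chi^a. The default value of
   odflt is therefore never used when a is a partition of n. *)
Definition partition_Iirr (n : nat) (a : seq nat) : Iirr [set: 'S_n] :=
  let a' := conj_partition a in
  odflt (0 : Iirr [set: 'S_n]) [pick i : Iirr [set: 'S_n] |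
     (i \in irr_constt ('Ind[[set: 'S_n], young_subgroup n a] 1))
  && (i \in irr_constt ('Ind[[set: 'S_n], young_subgroup n a']
                          ('Res[young_subgroup n a'] (sign_char n))))].

Definition partition_char (n : nat) (a : seq nat) : 'CF([set: 'S_n]) :=
  'chi_(partition_Iirr n a).

Definition p_vanishing (p m : nat) (c : seq nat) : Prop :=
  forall i : Iirr [set: 'S_m], (p %| 'chi_i 1%g)%C ->
  forall g : 'S_m, cycle_type g = c -> 'chi_i g = 0.

(* Main.v *)
Require Import Defs.
From mathcomp Require Import all_boot all_order all_algebra.
From mathcomp Require Import all_fingroup all_solvable all_field all_character.
From mathcomp Require Import zify.

Set Implicit Arguments.
Unset Strict Implicit.
Unset Printing Implicit Defensive.
Import Order.TTheory GRing.Theory Num.Theory.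
Local Open Scope ring_scope.

(** The point is that the Murnaghan-Nakayama rule removes the parts of beta one
after the other, so that the value of chi^alpha at beta is a signed sum, over
the sequences of I^alpha(beta_1, ..., beta_s), of values of
chi^(alpha^(s)_a) at (beta_(s+1), ..., beta_k).  Each of these characters has
degree divisible by p, hence vanishes on the class of the p-vanishing partition
(beta_(s+1), ..., beta_k).

The rule is derived from the determinantal form of the irreducible characters.
Let l be at least the number of parts of alpha, let delta be the staircase
(l - 1, ..., 1, 0), and let v be alpha + delta, where alpha is padded with zeros
to length l.  For a vector v define a number char_value v beta by removing the
parts r of beta from one coordinate of v at a time, in all possible ways, and by
ending with the signed count of the permutations w for which what remains of v
is delta o w.

Hooks.  char_value is alternating in v, so only the vectors with distinct
coordinates matter, and lower_beta_vector shows that subtracting r from a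
coordinate of alpha + delta either creates a repetition or yields, up to a
permutation, the vector of alpha with a hook of length r removed.  This gives
char_value_removal, by induction on the list of removed parts.

Characters.  Counting colourings of {0, ..., n - 1} by {0, ..., l - 1} which are
constant on the cycles of g, one finds (char_value_cycle_type) that
g |-> char_value v (cycle type of g) is the alternating sum over w of the
permutation characters of S_n on colourings with content v - delta o w.  It is
thus a generalised character psi, and it remains to see that it is the
irreducible character labelled by alpha.
- psi has norm 1.  The inner product of two permutation characters on colourings
  counts the matrices over the natural numbers with given margins
  (cfdot_coloring_char).  The alternating sum of these numbers satisfies the
  same recursion as the alternant (num_matrices_rec, sum_alternant_lower), and
  alternating_matricesE follows by induction: it is an elementary form of the
  Cauchy identity.
- Let E be the sign character induced from the Young subgroup of the conjugate
  partition.  The inner product of E with a permutation character on colourings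
  counts the 0-1 matrices with given margins.  There is such a matrix for w = 1,
  namely the diagram of alpha (ex_jointly_injective), and there is none for the
  other permutations w, whose row sums are too large
  (not_jointly_injective).  Hence psi has the same positive inner product as the
  permutation character with the constituent that labels chi^alpha, and being of
  norm 1 it is equal to it (partition_char_determinantal). *)

(** * Alternating sums over permutations of coordinates *)

Lemma sum_leq_nat x N : (\sum_(1 <= r < N.+1) (r <= x) = minn x N)%N.
Proof.
elim: N => [|N IH]; first by rewrite big_geq ?minn0.
by rewrite big_nat_recr //= IH; lia.
Qed.

Lemma sum_eq_nat m N :
  (\sum_(1 <= r < N.+1) (r == m) = (0 < m <= N))%N.
Proof.
elim: N => [|N IH]; first by rewrite big_geq //; case: m.
rewrite big_nat_recr //= IH.
by case: eqP; case: (leqP m N); case: (leqP m N.+1); case: (posnP m) => //=;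
  lia.
Qed.

Section Alternant.
Variable K : finType.
Implicit Types (v u x y : {ffun K -> nat}) (w s : {perm K}).

(** A non-dependent form of extensionality: both sides have type nat. *)
Lemma vecP v u : (forall a, v a = u a :> nat) <-> v = u.
Proof. exact: ffunP. Qed.

(** The vector v o w, with coordinates v (w a). *)
Definition permute v w : {ffun K -> nat} := [ffun a => v (w a)].

Lemma permuteM v s w : permute (permute v s) w = permute v (w * s)%g.
Proof. by apply/vecP=> a; rewrite !ffunE permM. Qed.

Lemma permute1 v : permute v 1%g = v.
Proof. by apply/vecP=> a; rewrite ffunE perm1. Qed.

Lemma permute_inj s : injective (permute^~ s).
Proof.
by apply: (can_inj (g := permute^~ s^-1%g)) => v;
  rewrite permuteM mulVg permute1.
Qed.

Lemma sum_permute v s : (\sum_a permute v s a = \sum_a v a)%N.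
Proof.
rewrite [RHS](reindex_inj (@perm_inj _ s)) /=.
by apply: eq_bigr => a _; rewrite ffunE.
Qed.

(** The sum of the signs of the permutations w with v = u o w, that is, the
determinant of the matrix with entries [v a = u b].  If v has distinct
coordinates, it is the sign of the rearrangement taking u to v, if any. *)
Definition alternant v u : algC :=
  \sum_(w : {perm K}) (-1) ^+ w * (v == permute u w)%:R.

Lemma alternant_permute v u s :
  alternant (permute v s) u = (-1) ^+ s * alternant v u.
Proof.
rewrite /alternant mulr_sumr (reindex_inj (mulgI s)) /=.
apply: eq_bigr => w _; rewrite -permuteM (inj_eq (@permute_inj s)).
by rewrite odd_permM signr_addb mulrA.
Qed.

Lemma alternantC v u : alternant v u = alternant u v.
Proof.
rewrite /alternant (reindex_inj invg_inj) /=; apply: eq_bigr => w _.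
rewrite odd_permV; congr (_ * _%:R); rewrite -[in LHS](inj_eq (@permute_inj w)).
by rewrite permuteM mulgV permute1 eq_sym.
Qed.

Lemma alternating_eq0 (f : {ffun K -> nat} -> algC) v :
    (forall s, f (permute v s) = (-1) ^+ s * f v) ->
  ~ injective v -> f v = 0.
Proof.
move=> fs /injectiveP/injectivePn[a [b neq_ab eq_v]].
have := fs (tperm a b); rewrite odd_tperm neq_ab expr1 mulN1r.
have -> : permute v (tperm a b) = v.
  by apply/vecP=> c; rewrite ffunE; case: tpermP => [->|->|].
by move/eqP; rewrite -addr_eq0 -mulr2n mulrn_eq0 => /eqP.
Qed.

Lemma alternant_eq0 v u : ~ injective v -> alternant v u = 0.
Proof.
by apply: (alternating_eq0 (f := alternant^~ u)) => s; apply: alternant_permute.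
Qed.

Lemma alternant_id v : injective v -> alternant v v = 1.
Proof.
move=> inj_v; rewrite /alternant (bigD1 1%g) //= permute1 eqxx odd_perm1 mulr1.
rewrite big1 ?addr0 // => w neq_w1; case: eqP => [/vecP eq_v|];
  last by rewrite mulr0.
case/eqP: neq_w1; apply/permP=> a; rewrite perm1; apply: inj_v.
by rewrite [RHS]eq_v ffunE.
Qed.

(** The vector v with r subtracted from its coordinate i.  The subtraction is
truncated, so lower is used together with the condition r <= v i. *)
Definition lower v i r : {ffun K -> nat} := [ffun a => v a - r * (a == i)]%N.

Lemma lower_permute v s i r :
  lower (permute v s) i r = permute (lower v (s i) r) s.
Proof. by apply/vecP=> a; rewrite !ffunE (inj_eq perm_inj). Qed.

Lemma sum_lower v i r : (r <= v i)%N ->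
  (\sum_a lower v i r a + r = \sum_a v a)%N.
Proof.
move=> le_r; rewrite (bigD1 i) //= [RHS](bigD1 i) //= ffunE eqxx.
under eq_bigr => a /negPf neq do rewrite ffunE neq muln0 subn0.
lia.
Qed.

(** The contribution to [sum_alternant_lower] of the pairs of equal indices. *)
Lemma sum_lower_diag x y i N : (x i <= N)%N ->
  (\sum_(1 <= r < N.+1) ([&& r <= x i, r <= y i & lower x i r == lower y i r]) =
   x i * (x == y))%N.
Proof.
move=> le_xN.
have E r : [&& r <= x i, r <= y i & lower x i r == lower y i r]%N =
           (r <= x i)%N && (x == y).
  case: (leqP r (x i)) => //= le_r.
  apply/idP/eqP=> [/andP[le_ry /eqP/vecP eq_l] | <-]; last by rewrite le_r eqxx.
  apply/vecP=> a; have:= eq_l a; rewrite !ffunE.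
  by case: eqP => [->|_]; rewrite ?muln1 ?muln0 ?subn0; lia.
under eq_bigr => r _ do rewrite E -mulnb.
rewrite -big_distrl /=; congr (_ * _)%N.
by rewrite sum_leq_nat; apply/minn_idPl.
Qed.

(** The vectors x and y agree outside i and j, with equal sums over i and j. *)
Definition agree_off x y i j :=
  [forall a, (a != i) && (a != j) ==> (x a == y a)] && (x i + x j == y i + y
    j)%N.

Lemma sum_lower_off x y i j N : i != j -> (x i <= N)%N ->
  (\sum_(1 <= r < N.+1) ([&& r <= x i, r <= y j & lower x i r == lower y j r]) =
   agree_off x y i j && (y i < x i))%N.
Proof.
move=> neq_ij le_xN.
have E r : (0 < r)%N -> [&& r <= x i, r <= y j & lower x i r == lower y j r]%N =
           (agree_off x y i j && (y i < x i)%N) && (r == x i - y i)%N.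
  move=> r0; apply/idP/idP.
    case/and3P=> le_rx le_ry /eqP/vecP eq_l.
    have := eq_l i; have := eq_l j;
      rewrite !ffunE !eqxx (negPf neq_ij) eq_sym (negPf neq_ij).
    rewrite !muln1 !muln0 !subn0 => e1 e2.
    apply/andP; split; last lia.
    apply/andP; split; last lia.
    apply/andP; split; last lia.
    apply/forallP=> a; apply/implyP=> /andP[/negPf ai /negPf aj].
    by have := eq_l a; rewrite !ffunE ai aj !muln0 !subn0 => ->.
  case/andP=> /andP[/andP[/forallP eq_a /eqP e] lt_yx] /eqP r_def.
  apply/and3P; split; [lia | lia | apply/eqP/vecP=> a; rewrite !ffunE].
  have [->|ai] := eqVneq a i; first by rewrite (negPf neq_ij); lia.
  have [->|aj] := eqVneq a j; first lia.
  by have := eq_a a; rewrite ai aj /= => /eqP ->.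
under eq_big_nat => r /andP[r0 _] do rewrite E // -mulnb.
rewrite -big_distrr /=; case: andP => [[_ lt_yx]|]; last by rewrite mul0n.
by rewrite mul1n sum_eq_nat; apply/eqP; rewrite eqb1; lia.
Qed.

Lemma agree_off_permute v u i j w : i != j ->
  agree_off v (permute u (tperm i j * w)) i j = agree_off v (permute u w) i j.
Proof.
move=> neq_ij; rewrite /agree_off !ffunE !permM tpermL tpermR.
rewrite [(u (w j) + _)%N]addnC; congr (_ && _).
apply: eq_forallb => a; case: (eqVneq a i) => //= ai;
  case: (eqVneq a j) => //= aj.
by rewrite !ffunE permM tpermD 1?[_ == a]eq_sym.
Qed.

Lemma sum_agree_off v u i j : i != j ->
  \sum_(w : {perm K}) (-1) ^+ w * (agree_off v (permute u w) i j)%:R =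
    0 :> algC.
Proof.
move=> neq_ij; set S := (X in X = 0).
suff : S = - S by move/eqP; rewrite -addr_eq0 -mulr2n mulrn_eq0 => /eqP.
rewrite {1}/S (reindex_inj (mulgI (tperm i j))) /= -sumrN.
apply: eq_bigr => w _; rewrite agree_off_permute // odd_permM odd_tperm neq_ij.
by rewrite signrN mulNr.
Qed.

(** Exchanging i and j cancels the terms without the condition v i <> u (w i);
the terms for which this condition fails are those with v = u o w. *)
Lemma sum_agree_off_neq v u i j : i != j ->
  \sum_(w : {perm K}) (-1) ^+ w *
     (agree_off v (permute u w) i j && (v i != permute u w i))%:R
  = - alternant v u.
Proof.
move=> neq_ij; transitivity (0 - alternant v u); last exact: sub0r.
rewrite -[X in _ = X - _](sum_agree_off v u neq_ij) -sumrB.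
apply: eq_bigr => w _; rewrite -mulrBr; congr (_ * _).
set y := permute u w.
suff -> : (v == y) = agree_off v y i j && (v i == y i).
  by case: agree_off; case: (v i == y i); rewrite /= ?subrr ?subr0.
apply/eqP/idP=> [->|/andP[/andP[/forallP eq_a /eqP e] /eqP ei]].
  rewrite /agree_off !eqxx !andbT; apply/forallP=> a; exact/implyP.
apply/vecP=> a; have [->//|ai] := eqVneq a i.
have [->|aj] := eqVneq a j; first lia.
by have := eq_a a; rewrite ai aj /= => /eqP.
Qed.

(** The recursion for alternants behind the Cauchy identity: lowering a
coordinate of v and a coordinate of u by the same positive amount, in all
possible ways, multiplies the alternant by the sum of v minus l(l-1)/2, where l
is the number of coordinates.  Both sides are doubled to avoid the half.  After
the expansion of the alternants over w, the pairs (i, w i) contribute the sum of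
the v i; the other pairs contribute -1 for each pair of distinct indices. *)
Lemma sum_alternant_lower v u N : (forall i, v i <= N)%N ->
  (\sum_i \sum_j \sum_(1 <= r < N.+1 | (r <= v i)%N && (r <= u j)%N)
      alternant (lower v i r) (lower u j r)) *+ 2 =
  (2 * \sum_i v i)%:R * alternant v u
     - (#|K| * #|K|.-1)%:R * alternant v u.
Proof.
move=> le_vN.
pose E x y i j := (\sum_(1 <= r < N.+1)
   ([&& r <= x i, r <= y j & lower x i r == lower y j r]))%N.
have -> : \sum_i \sum_j \sum_(1 <= r < N.+1 | (r <= v i)%N && (r <= u j)%N)
      alternant (lower v i r) (lower u j r)
   = \sum_(w : {perm K}) (-1) ^+ w * \sum_i \sum_j (E v (permute u w) i j)%:R.
  under [RHS]eq_bigr => w _.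
    rewrite mulr_sumr; under eq_bigr => i _ do rewrite mulr_sumr.
    over.
  rewrite [RHS]exchange_big; apply: eq_bigr => i _.
  have -> : \sum_(w : {perm K}) \sum_j (-1) ^+ w * (E v (permute u w) i j)%:R =
      \sum_j \sum_(w : {perm K}) (-1) ^+ w *
         (\sum_(1 <= r < N.+1) [&& r <= v i,
           r <= u j & lower v i r == permute (lower u j r) w])%N%:R :> algC.
    rewrite [RHS]exchange_big; apply: eq_bigr => w _.
    rewrite [RHS](reindex_inj (@perm_inj _ w)); apply: eq_bigr => j _.
    congr (_ * _%:R); apply: eq_bigr => r _; rewrite ffunE.
    by rewrite lower_permute.
  apply: eq_bigr => j _; rewrite /alternant exchange_big;
    apply: eq_bigr => w _ /=.
  rewrite natr_sum mulr_sumr big_mkcond; apply: eq_bigr => r _ /=.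
  by rewrite andbA; case: (_ && _); rewrite //= mulr0.
have Esum y : (\sum_i \sum_j E v y i j =
   (\sum_i v i) * (v == y) +
   \sum_i \sum_(j | j != i) (agree_off v y i j && (y i < v i)))%N.
  rewrite big_distrl -big_split /=; apply: eq_bigr => i _.
  rewrite (bigD1 i) //= [E _ _ _ _]sum_lower_diag //; congr (_ + _)%N.
  by apply: eq_bigr => j neq; rewrite [E _ _ _ _]sum_lower_off // eq_sym.
(* Adding the terms for (i, j) and (j, i) replaces < by <>. *)
have Esum2 y : (2 * (\sum_i \sum_j E v y i j) =
   2 * (\sum_i v i) * (v == y) +
   \sum_i \sum_(j | j != i) (agree_off v y i j && (v i != y i)))%N.
  rewrite Esum mulnDr mulnA [(2 * \sum_i \sum_(j | _) _)%N]mul2n -addnn;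
    congr (_ + _)%N.
  rewrite [X in (X + _)%N](exchange_big_dep predT) //= -big_split;
    apply: eq_bigr => i _ /=.
  under [X in (X + _)%N]eq_bigl => j do rewrite eq_sym.
  rewrite -big_split; apply: eq_bigr => j neq /=.
  have -> : agree_off v y j i = agree_off v y i j.
    rewrite /agree_off addnC [(y j + _)%N]addnC; congr (_ && _).
    by apply: eq_forallb => a; rewrite andbC.
  case A: (agree_off v y i j) => //=; move: A;
    rewrite /agree_off => /andP[_ /eqP A].
  case: (ltngtP (y i) (v i)); case: (ltngtP (y j) (v j)); lia.
rewrite -sumrMnl; under [LHS]eq_bigr => w _.
  have -> : ((-1) ^+ w * (\sum_i \sum_j (E v (permute u w) i j)%:R)) *+ 2 =
     (2 * \sum_i v i)%:R * ((-1) ^+ w * (v == permute u w)%:R) +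
     \sum_i \sum_(j | j != i) (-1) ^+ w *
       (agree_off v (permute u w) i j && (v i != permute u w i))%:R :> algC.
    have -> : \sum_i \sum_j (E v (permute u w) i j)%:R =
        (\sum_i \sum_j E v (permute u w) i j)%N%:R :> algC.
      by rewrite natr_sum; apply: eq_bigr => i _; rewrite natr_sum.
    rewrite -mulrnAr -mulr_natl -natrM Esum2 natrD natrM mulrDr mulrCA.
    congr (_ + _); rewrite natr_sum mulr_sumr; apply: eq_bigr => i _.
    by rewrite natr_sum mulr_sumr.
  over.
rewrite big_split /= -mulr_sumr; congr (_ + _).
rewrite exchange_big /=.
under eq_bigr => i _.
  rewrite exchange_big /=;
    under eq_bigr => j neq do rewrite sum_agree_off_neq 1?eq_sym //.
  rewrite sumr_const cardC1; over.
by rewrite sumr_const -mulrnA mulNrn mulr_natl mulnC.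
Qed.
End Alternant.

(** * Vectors, matrices and the Cauchy identity *)

(** The vector (l - 1, ..., 1, 0). *)
Definition staircase l : {ffun 'I_l -> nat} := [ffun a => val (rev_ord a)].

Lemma staircase_inj l : injective (@staircase l).
Proof. by move=> a b; rewrite !ffunE => /val_inj/rev_ord_inj. Qed.

Lemma sum_staircase l : (2 * \sum_a staircase l a = l * l.-1)%N.
Proof.
rewrite (reindex_inj rev_ord_inj) /=.
under eq_bigr => a _ do rewrite ffunE rev_ordK.
have := triangular_sum l.
rewrite big_mkord => ->; rewrite bin2 mul2n.
rewrite -[in RHS](odd_double_half (l * l.-1)) oddM.
by case: l => //= l; rewrite andNb.
Qed.

(** The staircase has the least sum among vectors with distinct coordinates. *)
Lemma inj_sum_staircase l (v : {ffun 'I_l -> nat}) :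
    injective v -> (\sum_a v a <= \sum_a staircase l a)%N ->
  exists s, v = permute (staircase l) s.
Proof.
(* The rank of v a among the coordinates of v is at most v a, and the ranks have
   the same sum as the staircase, so v is the vector of its ranks. *)
move=> inj_v le_v; pose below (a : 'I_l) := [set b | v b < v a]%N.
have lt_below a : (#|below a| < l)%N.
  rewrite -[X in (_ < X)%N]card_ord -cardsT; apply/proper_card/properP.
  by split; [exact: subsetT | exists a; rewrite ?inE ?ltnn].
pose rk a := Ordinal (lt_below a).
have below_lt a b : (v a < v b)%N -> (#|below a| < #|below b|)%N.
  move=> lt_ab; apply/proper_card/properP; split.
    by apply/subsetP=> c; rewrite !inE => /ltn_trans; apply.
  by exists a; rewrite inE ?ltnn.
have inj_rk : injective (fun a => rev_ord (rk a)).
  move=> a b /rev_ord_inj/(congr1 val) /= eq_ab; apply: inj_v.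
  by case: (ltngtP (v a) (v b)) => // /below_lt; rewrite eq_ab ltnn.
exists (perm inj_rk); set s := perm _.
have sE a : permute (staircase l) s a = #|below a|.
  by rewrite !ffunE permE rev_ordK.
have le_rk a : (#|below a| <= v a)%N.
  rewrite -[X in (_ <= X)%N](size_iota 0) cardE -(size_map v).
  apply: uniq_leq_size; first by rewrite map_inj_uniq ?enum_uniq.
  by move=> _ /mapP[b + ->]; rewrite mem_enum inE mem_iota add0n.
apply/vecP=> a; apply/eqP; rewrite eqn_leq [X in _ && (X <= _)%N]sE le_rk andbT.
rewrite -(sum_permute (staircase l) s) (bigD1 a) //= [X in (_ <= X)%N](bigD1 a)
  //= in le_v.
rewrite -(leq_add2r (\sum_(i < l | i != a) v i)); apply: leq_trans le_v _.
by rewrite leq_add2l; apply: leq_sum => i _; rewrite sE.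
Qed.

Section Matrices.
Variables (K : finType) (N : nat).
Implicit Types (A : {ffun K * K -> 'I_N.+1}) (v a u b : {ffun K -> nat}).

(** The row sums of A are v - a, its column sums u - b.  The entries of A are
bounded by N only to have finitely many matrices; N is meant to be at least
every coordinate of v. *)
Definition margins A v a u b :=
  [forall i, \sum_j A (i, j) + a i == v i]%N &&
  [forall j, \sum_i A (i, j) + b j == u j]%N.

Definition num_matrices v a u b := (\sum_A margins A v a u b)%N.

(** Matrices whose entry (i, j) is at least r correspond to matrices with row i
and column j lowered by r, by subtracting r from that entry. *)
Lemma sum_margins_lower v a u b i j r : (v i <= N)%N -> (0 < r)%N ->
  (\sum_A (margins A v a u b && (r <= A (i, j))) =
   ((r <= v i) && (r <= u j)) * num_matrices (lower v i r) a (lower u j r) b)%N.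
Proof.
move=> le_vN r0; pose k := (i, j).
pose h A : {ffun K * K -> 'I_N.+1} := [ffun c => inord (A c + r * (c == k))%N].
pose h' A : {ffun K * K -> 'I_N.+1} := [ffun c => inord (A c - r * (c == k))%N].
have hE A : (A k + r <= N)%N -> forall c, (h A c = A c + r * (c == k) :> nat)%N.
  move=> le_N c; rewrite ffunE inordK //; case: eqP => [->|_]; first by lia.
  by rewrite muln0 addn0.
have h'E A c : (h' A c = A c - r * (c == k) :> nat)%N.
  by rewrite ffunE inordK //; apply: leq_ltn_trans (ltn_ord (A c)); lia.
have rowE A i' : (A k + r <= N)%N ->
    (\sum_j' h A (i', j') = \sum_j' A (i', j') + r * (i' == i))%N.
  move=> le_N; under eq_bigr => j' _ do rewrite hE //.
  rewrite big_split -big_distrr /=; congr (_ + _ * _)%N.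
  under eq_bigr => j' _ do rewrite xpair_eqE -mulnb.
  rewrite -big_distrr /= (bigD1 j) //= eqxx big1 ?addn0 ?muln1 //.
  by move=> j' /negPf->.
have colE A j' : (A k + r <= N)%N ->
    (\sum_i' h A (i', j') = \sum_i' A (i', j') + r * (j' == j))%N.
  move=> le_N; under eq_bigr => i' _ do rewrite hE //.
  rewrite big_split -big_distrr /=; congr (_ + _ * _)%N.
  under eq_bigr => i' _ do rewrite xpair_eqE -mulnb.
  rewrite -big_distrl /= (bigD1 i) //= eqxx big1 ?addn0 ?mul1n //.
  by move=> i' /negPf->.
have margE A : (A k + r <= N)%N -> margins (h A) v a u b =
    [&& r <= v i, r <= u j & margins A (lower v i r) a (lower u j r) b]%N.
  move=> le_N; apply/andP/and3P.
    case=> /forallP rows /forallP cols.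
    have := rows i; have := cols j; rewrite rowE // colE // !eqxx.
    move=> le_u le_v; split; [lia | lia |].
    apply/andP; split; apply/forallP=> c.
      by have := rows c; rewrite rowE // ffunE; case: (c =P i) => [->|]; lia.
    by have := cols c; rewrite colE // ffunE; case: (c =P j) => [->|]; lia.
  case=> le_v le_u /andP[/forallP rows /forallP cols]; split; apply/forallP=> c.
    by have := rows c; rewrite rowE // ffunE; case: (c =P i) => [->|]; lia.
  by have := cols c; rewrite colE // ffunE; case: (c =P j) => [->|]; lia.
rewrite /num_matrices.
transitivity (\sum_(A | margins A v a u b && (r <= A k)%N) 1)%N.
  by rewrite [RHS]big_mkcond; apply: eq_bigr => A _; case: (_ && _).
rewrite (reindex_onto h h') => [|A /andP[_ le_r]]; last first.
  apply/ffunP=> c; apply/val_inj; rewrite /= hE.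
    by rewrite h'E; case: eqP => [->|_];
      rewrite ?muln1 ?muln0 ?subn0 ?addn0 ?subnK.
  by rewrite h'E eqxx muln1 subnK // -ltnS.
rewrite big_distrr [LHS]big_mkcond /=; apply: eq_bigr => A _.
rewrite mulnb -andbA; set X := (X in nat_of_bool X);
  set Y := (Y in if Y then _ else _).
suff -> : Y = X by case: (X).
rewrite /X /Y; have [le_N|lt_N] := leqP (A k + r)%N N.
  rewrite margE // hE // eqxx muln1 leq_addl /=.
  suff -> : h' (h A) == A by rewrite andbT andbA.
  by apply/eqP/ffunP=> c; apply/val_inj; rewrite /= h'E hE // addnK.
have -> : (r <= h A k)%N = false.
  by rewrite ffunE eqxx muln1 /inord /insubd insubF /=; lia.
rewrite andbF; symmetry;
  apply/negbTE/negP => /andP[/andP[le_v _] /andP[/forallP/(_ i) + _]].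
rewrite ffunE eqxx muln1 (bigD1 j) //= => /eqP e.
have : (A (i, j) <= v i - r)%N by rewrite -e -addnA leq_addr.
by rewrite leqNgt => /negP; apply; rewrite ltn_subLR // addnC;
  apply: leq_ltn_trans lt_N.
Qed.

(** Weighting a matrix with the sum n of its entries amounts to choosing an
entry A (i, j) and some r with 1 <= r <= A (i, j). *)
Lemma num_matrices_rec n v a u b :
    (forall i, v i <= N)%N -> (\sum_i v i = n + \sum_i a i)%N ->
  (n * num_matrices v a u b =
   \sum_i \sum_j \sum_(1 <= r < N.+1 | (r <= v i) && (r <= u j))
      num_matrices (lower v i r) a (lower u j r) b)%N.
Proof.
move=> le_vN sum_v; rewrite /num_matrices big_distrr /=.
transitivity (\sum_A \sum_i \sum_j \sum_(1 <= r < N.+1)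
    (margins A v a u b && (r <= A (i, j))))%N.
  apply: eq_bigr => A _; case: (boolP (margins _ _ _ _ _)) => [mA | _];
    last first.
    rewrite muln0; symmetry; apply: big1 => i _; apply: big1 => j _.
    by rewrite big1.
  rewrite muln1.
  have -> : n = (\sum_i \sum_j A (i, j))%N.
    case/andP: mA => /forallP rows _; apply/(@addIn (\sum_i a i)).
    by rewrite -sum_v -big_split /=; apply: eq_bigr => i _;
      rewrite (eqP (rows i)).
  apply: eq_bigr => i _; apply: eq_bigr => j _.
  by rewrite /= sum_leq_nat; symmetry; apply/minn_idPl; rewrite -ltnS.
rewrite exchange_big; apply: eq_bigr => i _.
rewrite exchange_big; apply: eq_bigr => j _.
rewrite exchange_big [RHS]big_mkcond /= big_nat [RHS]big_nat.
apply: eq_bigr => r /andP[r0 _]; rewrite sum_margins_lower //.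
by case: (_ && _); rewrite ?mul1n ?mul0n.
Qed.

Lemma num_matrices_le v a u b :
    (\sum_i v i = \sum_i u i)%N -> (\sum_i a i = \sum_i b i)%N ->
    (\sum_i v i <= \sum_i a i)%N ->
  num_matrices v a u b = ((v == a) && (u == b)).
Proof.
move=> eq_vu eq_ab le_va.
have eq0 A : margins A v a u b -> A = [ffun=> ord0].
  case/andP=> /forallP rows _; apply/ffunP=> -[i j]; rewrite ffunE;
    apply: val_inj => /=.
  have : (\sum_i \sum_j A (i, j) + \sum_i a i = \sum_i v i)%N.
    by rewrite -big_split /=; apply: eq_bigr => i' _; rewrite (eqP (rows i')).
  rewrite (bigD1 i) //= (bigD1 j) //=; lia.
rewrite /num_matrices (bigD1 [ffun=> ord0]) //= [X in (_ + X)%N]big1 ?addn0.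
  congr nat_of_bool; rewrite /margins; congr (_ && _).
    apply/forallP/eqP=> [rows | -> i].
      by apply/vecP=> i; rewrite -(eqP (rows i)) big1 // => j _; rewrite ffunE.
    by rewrite big1 // => j _; rewrite ffunE.
  apply/forallP/eqP=> [rows | -> i].
    by apply/vecP=> i; rewrite -(eqP (rows i)) big1 // => j _; rewrite ffunE.
  by rewrite big1 // => j _; rewrite ffunE.
by move=> A neq; case: (boolP (margins _ _ _ _ _)) => // /eq0 A0;
  rewrite A0 eqxx in neq.
Qed.

End Matrices.

Section Cauchy.
Variables (l N : nat).
Implicit Types (v u : {ffun 'I_l -> nat}).
Let d := staircase l.

(** The number of matrices with margins v - delta o w and u - delta o w', summed
over w and w' with signs. *)
Definition alternating_matrices v u : algC :=
  \sum_(w : 'S_l) \sum_(w' : 'S_l) (-1) ^+ w * ((-1) ^+ w' *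
     (num_matrices N v (permute d w) u (permute d w'))%:R).

Lemma alternant_staircase_split v u :
    (\sum_i v i = \sum_i u i)%N -> (\sum_i v i <= \sum_i d i)%N ->
  alternant v d * alternant u d = alternant v u.
Proof.
move=> eq_vu le_vd.
case: (boolP (injectiveb v)) => [/injectiveP inj_v | /injectiveP ninj];
  last first.
  by rewrite !(@alternant_eq0 _ v) // mul0r.
case: (boolP (injectiveb u)) => [/injectiveP inj_u | /injectiveP ninj];
  last first.
  by rewrite [alternant v u]alternantC !(@alternant_eq0 _ u) // mulr0.
have [s ->] := inj_sum_staircase inj_v le_vd.
have [|t ->] := inj_sum_staircase inj_u; first by rewrite -eq_vu.
rewrite !alternant_permute [alternant d (permute d t)]alternantC
  alternant_permute.
by rewrite alternant_id ?mulr1 //; exact: staircase_inj.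
Qed.

(** The Cauchy identity, in terms of coefficients.  Above the sum of the
staircase, both sides satisfy the same recursion; at or below it, only the zero
matrix can occur. *)
Lemma alternating_matricesE v u :
    (forall i, v i <= N)%N -> (\sum_i v i = \sum_i u i)%N ->
  alternating_matrices v u = alternant v u.
Proof.
have [m] := ubnP (\sum_i v i)%N; elim: m v u => // m IH v u lt_m le_vN eq_vu.
case: (leqP (\sum_i v i)%N (\sum_i d i)%N) => [le_vd | lt_dv].
  rewrite -alternant_staircase_split // mulr_suml; apply: eq_bigr => w _.
  rewrite mulr_sumr; apply: eq_bigr => w' _.
  rewrite num_matrices_le ?sum_permute // -mulnb natrM.
  by rewrite mulrACA mulrA.
pose n := (\sum_i v i - \sum_i d i)%N.
have n0 : (n%:R : algC) != 0 by rewrite pnatr_eq0 /n; lia.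
apply: (mulfI n0).
transitivity (\sum_i \sum_j \sum_(1 <= r < N.+1 | (r <= v i)%N && (r <= u j)%N)
      alternating_matrices (lower v i r) (lower u j r)).
  rewrite /alternating_matrices.
  under [RHS]eq_bigr => i _.
    under eq_bigr => j _.
      rewrite exchange_big /=; under eq_bigr => w _ do rewrite exchange_big /=;
        over.
    rewrite exchange_big /=; under eq_bigr => w _ do rewrite exchange_big /=;
      over.
  rewrite [RHS]exchange_big mulr_sumr; apply: eq_bigr => w _.
  rewrite [RHS]exchange_big mulr_sumr; apply: eq_bigr => w' _.
  rewrite mulrCA (mulrCA n%:R) -natrM (@num_matrices_rec _ _ n) //; last first.
    by rewrite sum_permute subnK // ltnW.
  rewrite natr_sum !mulr_sumr; apply: eq_bigr => i _.
  rewrite natr_sum !mulr_sumr; apply: eq_bigr => j _.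
  by rewrite natr_sum !mulr_sumr; apply: eq_bigr.
transitivity (\sum_i \sum_j \sum_(1 <= r < N.+1 | (r <= v i)%N && (r <= u j)%N)
      alternant (lower v i r) (lower u j r)).
  apply: eq_bigr => i _; apply: eq_bigr => j _;
    rewrite big_nat_cond [RHS]big_nat_cond.
  apply: eq_bigr => r /andP[/andP[r0 _] /andP[le_rv le_ru]].
  have := sum_lower le_rv; have := sum_lower le_ru => e1 e2.
  apply: IH => [|a|]; last by apply/(@addIn r); rewrite e2 e1.
    by rewrite -ltnS -addn1 (leq_trans _ lt_m) // ltnS -e2 leq_add2l.
  by rewrite ffunE (leq_trans _ (le_vN a)) // leq_subr.
have := sum_alternant_lower u le_vN.
rewrite card_ord -sum_staircase -mulrBl -natrB; last by rewrite leq_mul2l ltnW.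
rewrite -mulnBr -/n -[X in X = _ -> _]mulr_natl natrM -mulrA.
by apply: mulfI; rewrite pnatr_eq0.
Qed.
End Cauchy.

(** * Colourings fixed by permutations *)
Section Colorings.
Variables (n : nat) (K : finType).
Implicit Types (c : {ffun 'I_n -> K}) (v u : {ffun K -> nat}) (g y : 'S_n).

(** The number of points of each colour. *)
Definition content c : {ffun K -> nat} := [ffun k => #|[set x | c x == k]|].

(** The colouring c is constant on the cycles of g. *)
Definition fixes g c := [forall x, c (g x) == c x].

Definition recolor c g : {ffun 'I_n -> K} := [ffun x => c (g x)].

Lemma fixesE g c : fixes g c = (c == recolor c g).
Proof.
apply/forallP/eqP=> [fix_c | {2}-> x]; last by rewrite ffunE.
by apply/ffunP=> x; rewrite ffunE (eqP (fix_c x)).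
Qed.

Lemma recolorM c g y : recolor (recolor c y) g = recolor c (g * y)%g.
Proof. by apply/ffunP=> x; rewrite !ffunE permM. Qed.

Lemma content_recolor c g : content (recolor c g) = content c.
Proof.
apply/vecP=> k; rewrite !ffunE -(card_imset _ (@perm_inj _ g)).
apply: eq_card => x; rewrite inE; apply/imsetP/idP=> [[y + ->]|cx].
  by rewrite inE ffunE.
by exists (g^-1 x)%g; rewrite ?inE ?ffunE permKV.
Qed.

Lemma count_map_enum (f : 'I_n -> K) k :
  count_mem k [seq f x | x <- enum 'I_n] = #|[set x | f x == k]|.
Proof.
rewrite count_map -sum1_count -sum1_card big_enum_cond /=.
by apply: eq_bigl => x; rewrite !inE.
Qed.

Lemma eq_contentP c c' : content c = content c' -> exists y, c' = recolor c y.
Proof.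
move=> eq_c; have /tuple_permP[y eq_y] :
    perm_eq [tuple c' x | x < n] [tuple c x | x < n].
  apply/allP=> k _; rewrite /= !count_map_enum.
  by have /vecP/(_ k) := eq_c; rewrite !ffunE => ->.
exists y; apply/ffunP=> x; rewrite ffunE.
by have := congr1 (fun t => tnth t x) (val_inj eq_y); rewrite !tnth_mktuple.
Qed.

Lemma ex_content v : (\sum_k v k = n)%N -> exists c, content c = v.
Proof.
move=> sum_v; pose s := flatten [seq nseq (v k) k | k <- enum K].
have size_s : size s == n.
  rewrite size_flatten /shape -map_comp -sum_v; apply/eqP.
  rewrite sumnE big_map -big_enum /=.
  by apply: eq_bigr => k _; rewrite size_nseq.
exists [ffun x => tnth (Tuple size_s) x]; apply/vecP=> k; rewrite ffunE.
transitivity (count_mem k (Tuple size_s)).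
  rewrite -map_tnth_enum count_map_enum.
  by apply: eq_card => x; rewrite !inE ffunE.
rewrite /= count_flatten -map_comp sumnE big_map big_enum /= (bigD1 k) //=.
rewrite count_nseq /= eqxx mul1n big1 ?addn0 // => k' /negPf neq.
by rewrite count_nseq /= neq.
Qed.

(** The colourings with the same content form one orbit under recolouring, so by
the orbit-stabiliser formula their stabilisers have n! elements in all. *)
Lemma sum_fixes_orbit c0 :
  (\sum_(c | content c == content c0) \sum_g fixes g c = n`!)%N.
Proof.
transitivity (\sum_(c | content c == content c0) \sum_y (c == recolor c0 y))%N.
  apply: eq_bigr => c /eqP eq_c.
  have [y0 c_def] := eq_contentP (esym eq_c).
  rewrite [RHS](reindex_inj (mulIg y0)) /=; apply: eq_bigr => g _.
  by rewrite fixesE -recolorM -c_def.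
rewrite exchange_big /= -card_Sn -sum1_card.
apply: eq_big => // y _;
  rewrite (bigD1 (recolor c0 y)) ?content_recolor //= eqxx.
by rewrite big1 ?addn0 // => c /andP[_ /negPf->].
Qed.

(** The content of c is v - u. *)
Definition extends v u c := [forall k, content c k + u k == v k]%N.

(** The number of colourings with content v - u fixed by g. *)
Definition num_fixed v u g := (\sum_(c | extends v u c) fixes g c)%N.

End Colorings.

Section Pairs.
Variables (n N : nat) (K : finType).
Implicit Types (v u a b : {ffun K -> nat}) (g : 'S_n).

(** A pair of colourings is a colouring by pairs, whose content is a matrix;
each matrix with the required margins arises from one orbit of colourings. *)
Lemma sum_num_fixed v a u b :
    (forall i, v i <= N)%N -> (\sum_i v i = n + \sum_i a i)%N ->
  (\sum_(g : 'S_n) num_fixed v a g * num_fixed u b g =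
    n`! * num_matrices N v a u b)%N.
Proof.
move=> le_vN sum_v.
pose T := {ffun 'I_n -> K * K}.
pose parts (e : T) : {ffun 'I_n -> K} * {ffun 'I_n -> K} :=
  ([ffun x => (e x).1], [ffun x => (e x).2]).
have parts_bij : bijective parts.
  exists (fun p : {ffun 'I_n -> K} * {ffun 'I_n -> K} =>
            [ffun x => (p.1 x, p.2 x)] : T) => [e|[c d]].
    by apply/ffunP=> x; rewrite !ffunE -surjective_pairing.
  by congr (_, _); apply/ffunP=> x; rewrite !ffunE.
pose marg (e : T) := extends v a (parts e).1 && extends u b (parts e).2.
have contentE1 (e : T) i : (content (parts e).1 i = \sum_j content e (i, j))%N.
  rewrite ffunE -sum1_card (partition_big (fun x => (e x).2) predT) //=.
  apply: eq_bigr => j _; rewrite ffunE -sum1_card; apply: eq_bigl => x.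
  by rewrite !inE ffunE -xpair_eqE -surjective_pairing.
have contentE2 (e : T) j : (content (parts e).2 j = \sum_i content e (i, j))%N.
  rewrite ffunE -sum1_card (partition_big (fun x => (e x).1) predT) //=.
  apply: eq_bigr => i _; rewrite ffunE -sum1_card; apply: eq_bigl => x.
  by rewrite !inE ffunE andbC -xpair_eqE -surjective_pairing.
(* The content of e as a matrix with bounded entries; the bound N does not bite
   when the margins of e are v - a and u - b. *)
pose bc (e : T) : {ffun K * K -> 'I_N.+1} := [ffun k => inord (content e k)].
have bcE e k : marg e -> bc e k = content e k :> nat.
  case: k => i j /andP[/forallP/(_ i)/eqP + _];
    rewrite contentE1 (bigD1 j) //= => e_v.
  by rewrite ffunE inordK // ltnS (leq_trans _ (le_vN i)) // -e_v -!addnA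
    leq_addr.
transitivity (\sum_(e : T | marg e) \sum_g fixes g e)%N.
  rewrite [RHS]exchange_big /=; apply: eq_bigr => g _.
  rewrite /num_fixed big_distrl /=.
  under eq_bigr => c _ do rewrite big_distrr.
  rewrite pair_big /= (reindex parts) /=; last by apply: onW_bij.
  apply: eq_bigr => e _; rewrite mulnb; congr nat_of_bool.
  apply/andP/forallP=> [[/forallP f1 /forallP f2] x | f].
    have := f1 x; have := f2 x; rewrite !ffunE => /eqP e2 /eqP e1.
    by rewrite [e (g x)]surjective_pairing [e x]surjective_pairing e1 e2.
  by split; apply/forallP=> x; rewrite !ffunE (eqP (f x)).
rewrite (partition_big bc predT) //= /num_matrices big_distrr.
apply: eq_bigr => A _ /=.
have [mA | /negP not_mA] := boolP (margins _ _ _ _ _); last first.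
  rewrite muln0 big1 // => e /andP[me /eqP eA]; case: not_mA; move: (me).
  case/andP=> /forallP rows /forallP cols; apply/andP; split; apply/forallP=> k.
    rewrite -(eqP (rows k)) contentE1 eqn_add2r; apply/eqP/eq_bigr => j _.
    by rewrite -eA bcE.
  rewrite -(eqP (cols k)) contentE2 eqn_add2r; apply/eqP/eq_bigr => j _.
  by rewrite -eA bcE.
pose A' : {ffun K * K -> nat} := [ffun k => val (A k)].
have [|e0 e0A] := @ex_content n _ A'.
  apply/(@addIn (\sum_i a i)); rewrite -sum_v.
  have -> : (\sum_k A' k = \sum_i \sum_j A' (i, j))%N.
    by rewrite pair_bigA; apply: eq_bigr => -[].
  rewrite -big_split /=.
  case/andP: mA => /forallP rows _; apply: eq_bigr => i _.
  by rewrite -(eqP (rows i)); congr (_ + _)%N; apply: eq_bigr => j _;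
    rewrite ffunE.
rewrite muln1 -(sum_fixes_orbit e0) e0A; apply: eq_bigl => e.
apply/andP/eqP => [[me /eqP eA] | eA].
  by apply/vecP=> k; rewrite -bcE // eA ffunE.
have me : marg e.
  case/andP: mA => /forallP rows /forallP cols.
  apply/andP; split; apply/forallP=> k.
    rewrite -(eqP (rows k)) contentE1 eqn_add2r; apply/eqP/eq_bigr => j _.
    by rewrite eA ffunE.
  rewrite -(eqP (cols k)) contentE2 eqn_add2r; apply/eqP/eq_bigr => j _.
  by rewrite eA ffunE.
by split=> //; apply/eqP/ffunP=> k; apply: val_inj; rewrite /= bcE // eA ffunE.
Qed.

End Pairs.

Section Signed.
Variables (n : nat) (K L : finType).

(** No two points have the same colour for both c and d: the matrix of the pair
(c, d) has entries 0 and 1 only. *)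
Definition jointly_injective (c : {ffun 'I_n -> K}) (d : {ffun 'I_n -> L}) :=
  injectiveb [ffun x => (c x, d x)].

(** The joint stabiliser is trivial in the injective case, and contains a
transposition otherwise. *)
Lemma sum_sign_fixes (c : {ffun 'I_n -> K}) (d : {ffun 'I_n -> L}) :
  \sum_(g : 'S_n) (-1) ^+ g * (fixes g c && fixes g d)%:R
    = (jointly_injective c d)%:R :> algC.
Proof.
case: (boolP (jointly_injective c d)) => [/injectiveP inj_cd | /injectivePn].
  rewrite (bigD1 1%g) //= odd_perm1 mul1r big1 ?addr0.
    suff -> : fixes 1%g c && fixes 1%g d by [].
    apply/andP; split; apply/forallP=> x;
    by rewrite perm1.
  move=> g neq_g1; case: (boolP (_ && _)); last by rewrite mulr0.
  case/andP=> /forallP fc /forallP fd; case/eqP: neq_g1; apply/permP=> x.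
  by rewrite perm1; apply: inj_cd; rewrite !ffunE (eqP (fc x)) (eqP (fd x)).
case=> x [y neq_xy]; rewrite !ffunE => -[eq_c eq_d].
set S := (X in X = _); suff : S = - S.
  by move/eqP; rewrite -addr_eq0 -mulr2n mulrn_eq0 => /eqP.
rewrite {1}/S (reindex_inj (mulIg (tperm x y))) -sumrN /=.
apply: eq_bigr => g _; rewrite odd_permM odd_tperm neq_xy addbT signrN mulNr.
have tp (M : finType) (e : {ffun 'I_n -> M}) : e x = e y ->
    fixes (g * tperm x y)%g e = fixes g e.
  move=> eq_e; apply: eq_forallb => z; rewrite permM.
  by case: tpermP => [->|->|//]; rewrite eq_e.
by rewrite !tp.
Qed.

Lemma sum_sign_num_fixed (v u : {ffun K -> nat}) (v' u' : {ffun L -> nat}) :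
  \sum_(g : 'S_n) (-1) ^+ g * ((num_fixed v u g)%:R * (num_fixed v' u' g)%:R)
  = \sum_(c | extends v u c) \sum_(d | extends v' u' d)
      (jointly_injective c d)%:R :> algC.
Proof.
under [RHS]eq_bigr => c _.
  under eq_bigr => d _ do rewrite -sum_sign_fixes.
  rewrite exchange_big; over.
rewrite [RHS]exchange_big /=; apply: eq_bigr => g _.
rewrite /num_fixed !natr_sum mulr_suml mulr_sumr; apply: eq_bigr => c _.
rewrite mulr_sumr mulr_sumr; apply: eq_bigr => d _.
by rewrite -natrM mulnb.
Qed.
End Signed.

(** * Beta vectors and removal of hooks *)

(** The value at the class of cycle type b of the generalised character attached
to v; the Murnaghan-Nakayama rule serves as definition.  It is the coefficient
of x^v in the product of the Vandermonde alternant by the power sums p_r(x), for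
r in b. *)
Fixpoint char_value l (v : {ffun 'I_l -> nat}) (b : seq nat) : algC :=
  if b is r :: b' then \sum_(i | (r <= v i)%N) char_value (lower v i r) b'
  else alternant v (staircase l).

Lemma char_value_permute l (v : {ffun 'I_l -> nat}) b s :
  char_value (permute v s) b = (-1) ^+ s * char_value v b.
Proof.
elim: b v => [|r b IH] v; first exact: alternant_permute.
rewrite /= mulr_sumr [RHS](reindex_inj (@perm_inj _ s)) /=.
by apply: eq_big => [i|i _]; rewrite ?ffunE // lower_permute IH.
Qed.

Lemma char_value_eq0 l (v : {ffun 'I_l -> nat}) b :
  ~ injective v -> char_value v b = 0.
Proof.
by apply: (alternating_eq0 (f := fun v => char_value v b)) => s;
   apply: char_value_permute.
Qed.

Section Diagrams.
Local Open Scope nat_scope.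

Lemma mem_diagram a i j : ((i, j) \in diagram a) = (j < nth 0 a i).
Proof.
apply/allpairsPdep/idP=> [[i' [j' [_ + [-> ->]]]] | lt_j].
  by rewrite mem_iota.
exists i, j; rewrite !mem_iota; split=> //=.
by rewrite add0n; apply: contraTT lt_j; rewrite -!leqNgt => /(nth_default 0)->.
Qed.

Lemma sum_iota_ord n (F : nat -> nat) :
  sumn [seq F i | i <- iota 0 n] = \sum_(i < n) F i.
Proof. by rewrite sumnE big_map -(big_mkord xpredT F) /index_iota subn0. Qed.

Lemma count_iota (P : pred nat) n : count P (iota 0 n) = \sum_(i < n) P i.
Proof.
rewrite -sum1_count big_mkcond -{1}(subn0 n) -/(index_iota 0 n) big_mkord.
by apply: eq_bigr => i _; case: (P i).
Qed.

Lemma count_diagram (P : pred (nat * nat)) a :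
  count P (diagram a) = \sum_(i < size a) \sum_(j < nth 0 a i) P (val i, val j).
Proof.
rewrite /diagram count_flatten -map_comp sum_iota_ord; apply: eq_bigr => i _.
by rewrite /= count_map count_iota.
Qed.

Lemma sumn_nth a l : size a <= l -> sumn a = \sum_(i < l) nth 0 a i.
Proof.
move=> le_l; rewrite sumnE (big_nth 0) big_mkord (big_ord_widen l (nth 0 a)) //.
rewrite big_mkcond; apply: eq_bigr => i _;
  case: ltnP => // /(nth_default 0)-> //.
Qed.

Lemma sum_ord_lt m t : \sum_(j < m) (j < t) = minn m t.
Proof.
by elim: m => [|m IH]; rewrite ?big_ord0 ?min0n // big_ord_recr /= IH; lia.
Qed.

Lemma nth_filter_pos s t : sorted geq s ->
  nth 0 [seq r <- s | 0 < r] t = nth 0 s t.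
Proof.
elim: s t => //= x s IH t path_s.
have sorted_s := path_sorted path_s.
case: posnP => [x0 | _]; last by case: t => //= t; apply: IH.
have /allP le_x : all (geq x) s by apply: order_path_min path_s => a b c /=;
  lia.
have s0 y : y \in s -> y = 0 by move/le_x; rewrite x0 /=; lia.
rewrite (eq_in_filter (a2 := pred0)); last by move=> y /s0 ->.
rewrite filter_pred0 nth_nil; case: t => //= t.
by case: (ltnP t (size s)) => [/(mem_nth 0)/s0 -> | /(nth_default 0)->].
Qed.

Lemma nth_partition_le n a i j : is_partition n a -> i <= j ->
  nth 0 a j <= nth 0 a i.
Proof.
case/and3P=> sorted_a _ _ le_ij.
case: (ltnP j (size a)) => [lt_j | /(nth_default 0)-> //].
have tr : transitive geq by move=> x y z /=; lia.
have rf : reflexive geq by move=> x /=; lia.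
by apply: (sorted_leq_nth tr rf 0 sorted_a);
  rewrite ?inE ?(leq_ltn_trans le_ij).
Qed.

Lemma nth_gt0_size a k j : j < nth 0 a k -> k < size a.
Proof. by apply: contraTT; rewrite -!leqNgt => /(nth_default 0)->. Qed.

(** Indices are numbered from 0, and nth 0 a t is 0 past the last row.  Below,
k is the last row of length more than j, so that the hook of (i, j) has its arm
in row i and its leg down to row k. *)
Section RemoveHook.
Variables (n : nat) (a : seq nat) (i k j : nat).
Hypotheses (part_a : is_partition n a) (le_ik : i <= k).
Hypotheses (le_j : nth 0 a k.+1 <= j) (lt_j : j < nth 0 a k).

Let le_a t t' : t <= t' -> nth 0 a t' <= nth 0 a t.
Proof. exact: nth_partition_le part_a. Qed.

Let lt_j_le t : t <= k -> j < nth 0 a t.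
Proof. by move=> le_t; apply: leq_trans lt_j (le_a _). Qed.

Let le_j_gt t : k < t -> nth 0 a t <= j.
Proof. by move=> lt_t; apply: leq_trans (le_a _) le_j. Qed.

Lemma hook_node : (i, j) \in diagram a.
Proof. by rewrite mem_diagram lt_j_le. Qed.

Lemma hook_lengthE : hook_length a (i, j) = nth 0 a i - j + (k - i).
Proof.
rewrite /hook_length /hook size_filter count_diagram /=.
have lt_i : i < size a by apply: nth_gt0_size (lt_j_le le_ik).
have lt_k : k < size a by apply: nth_gt0_size lt_j.
transitivity
  (\sum_(t < size a) ((nth 0 a i - j) * (t == i :> nat) + (i < t <= k))).
  apply: eq_bigr => t _.
  have [e|t_i] := eqVneq (t : nat) i.
    rewrite e ltnn leqnn /= muln1 addn0.
    transitivity (\sum_(u < nth 0 a i) (j <= u)).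
      by apply: eq_bigr => u _; rewrite andbT; case: ltngtP.
    have := sum_ord_lt (nth 0 a i) j.
    have : \sum_(u < nth 0 a i) (u < j) + \sum_(u < nth 0 a i) (j <= u) =
      nth 0 a i.
      rewrite -big_split -[RHS]card_ord -sum1_card; apply: eq_bigr => u _ /=.
      by case: ltnP.
    have := lt_j_le le_ik; lia.
  rewrite muln0 add0n /=; have [lt_it|] := ltnP i t; last first.
    by move=> le_ti; rewrite big1 // => u _;
      rewrite leqNgt ltn_neqAle t_i le_ti andbF.
  rewrite (ltnW lt_it) /=; have [le_tk|lt_kt] := leqP t k.
    rewrite (bigD1 (Ordinal (lt_j_le le_tk))) //= eqxx big1 // => u.
    by rewrite -val_eqE /= => /negPf->.
  rewrite big1 // => u _; case: eqP => // e; have := ltn_ord u.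
  by have := le_j_gt lt_kt; lia.
rewrite big_split -big_distrr /=; congr (_ + _).
  rewrite (bigD1 (Ordinal lt_i)) //= eqxx big1 ?addn0 ?muln1 //.
  by move=> t; rewrite -val_eqE /= => /negPf->.
have lem m : \sum_(t < m) (i < t <= k) = minn m k.+1 - minn m i.+1.
  by elim: m => [|m IH]; rewrite ?big_ord0 // big_ord_recr /= IH; lia.
by rewrite lem; lia.
Qed.

(** The length of row t after the removal of the hook at (i, j). *)
Definition removed_row t :=
  if t < i then nth 0 a t else minn (nth 0 a t) (maxn j (nth 0 a t.+1).-1).

Lemma remove_hookE :
  remove_hook a (i, j) = [seq r <- mkseq removed_row (size a) | 0 < r].
Proof using.
rewrite /remove_hook; congr filter; rewrite /mkseq; apply/eq_in_map => t.
rewrite mem_iota add0n => /= lt_t.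
rewrite count_diagram (bigD1 (Ordinal lt_t)) //= [X in _ + X]big1 ?addn0;
  last first.
  by move=> t'; rewrite -val_eqE /= => /negPf neq; rewrite big1 // => u _;
    rewrite neq.
rewrite /removed_row; case: ltnP => [lt_ti | le_it].
  rewrite -[RHS]card_ord -sum1_card; apply: eq_bigr => u _ /=.
  by rewrite eqxx mem_filter /= leqNgt lt_ti.
rewrite -sum_ord_lt; apply: eq_bigr => u _ /=.
rewrite eqxx mem_filter /= !mem_diagram ltn_ord le_it andbT /=.
by congr nat_of_bool; clear -u; lia.
Qed.

Lemma sorted_removed_row m : sorted geq (mkseq removed_row m).
Proof using part_a.
apply/(sortedP 0) => t; rewrite size_mkseq => lt_t.
rewrite !nth_mkseq //=; last exact: ltnW.
have := le_a (leqnSn t); have := le_a (leqnSn t.+1); rewrite /removed_row.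
by clear -t; case: (ltnP t.+1 i); case: (ltnP t i); lia.
Qed.

Lemma nth_remove_hook t : nth 0 (remove_hook a (i, j)) t = removed_row t.
Proof using part_a.
rewrite remove_hookE nth_filter_pos ?sorted_removed_row //.
have [lt_t|le_t] := ltnP t (size a); first by rewrite nth_mkseq.
rewrite nth_default ?size_mkseq // /removed_row [nth 0 a t]nth_default // min0n.
by case: ifP.
Qed.

Lemma size_remove_hook : size (remove_hook a (i, j)) <= size a.
Proof using.
by rewrite remove_hookE size_filter (leq_trans (count_size _ _)) // size_mkseq.
Qed.

Lemma removed_row_lt t : i <= t < k -> removed_row t = (nth 0 a t.+1).-1.
Proof using part_a lt_j.
move=> /andP[le_it lt_tk]; rewrite /removed_row ltnNge le_it /=.
have := lt_j_le lt_tk; have := le_a (leqnSn t).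
by clear -t; lia.
Qed.

Lemma removed_row_eq : removed_row k = j.
Proof using le_ik le_j lt_j.
by rewrite /removed_row ltnNge le_ik /=; move: lt_j le_j; clear; lia.
Qed.

Lemma removed_row_gt t : k < t -> removed_row t = nth 0 a t.
Proof using part_a le_ik le_j.
move=> lt_t; have lt_it := leq_ltn_trans le_ik lt_t.
rewrite /removed_row ltnNge (ltnW lt_it) /=; have := le_j_gt lt_t.
by clear -t; lia.
Qed.

Lemma remove_hook_shape :
  is_partition (sumn (remove_hook a (i, j))) (remove_hook a (i, j)).
Proof using part_a.
apply/and3P; split=> //; last by rewrite mem_filter.
rewrite remove_hookE; apply: sorted_filter; last exact: sorted_removed_row.
by move=> x y z /=; clear -x; lia.
Qed.

End RemoveHook.
End Diagrams.

(** The beta numbers of a, that is, alpha + delta when a is the partition alpha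
padded with empty rows to have l rows. *)
Definition beta_vector l (a : seq nat) : {ffun 'I_l -> nat} :=
  [ffun t : 'I_l => (nth 0 a t + staircase l t)%N].

Lemma sum_beta_vector l a : (size a <= l)%N ->
  (\sum_t beta_vector l a t = sumn a + \sum_t staircase l t)%N.
Proof.
move=> le_l; rewrite (sumn_nth le_l) -big_split.
by apply: eq_bigr => t _; rewrite ffunE.
Qed.

Lemma beta_vector_inj n l a : is_partition n a -> injective (beta_vector l a).
Proof.
move=> part_a t t'; rewrite !ffunE /= => eq_tt'; apply: val_inj => /=.
have [lt_t lt_t'] := (ltn_ord t, ltn_ord t').
by case: (ltngtP t t') => // lt_tt;
  have := nth_partition_le part_a (ltnW lt_tt); lia.
Qed.

(** If lowering coordinate i of alpha + delta by r leaves distinct coordinates,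
then the result is a rearrangement of the beta vector of alpha without a hook of
length r.  The corner of the hook is in row i; its leg ends in
row k, the last row whose coordinate exceeds the lowered value t0, and t0 moves
to row k while the rows below row i, down to row k, move up by one. *)
Lemma lower_beta_vector n l a (i : 'I_l) r :
    is_partition n a -> (size a <= l)%N -> (0 < r)%N ->
    (r <= beta_vector l a i)%N -> injective (lower (beta_vector l a) i r) ->
  exists x, [/\ x \in diagram a, hook_length a x = r,
    is_partition (n - r) (remove_hook a x), (size (remove_hook a x) <= l)%N
    & exists s, lower (beta_vector l a) i r =
      permute (beta_vector l (remove_hook a x)) s].
Proof.
move=> part_a le_l r0 le_r inj_low.
pose b t := (nth 0 a t + (l - t.+1))%N.
have vE (t : 'I_l) : beta_vector l a t = b t by rewrite !ffunE.
have lowE (t : 'I_l) : lower (beta_vector l a) i r t = (b t - r * (t == i))%N.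
  by rewrite ffunE vE.
rewrite vE in le_r; pose t0 := (b i - r)%N.
pose P t := [&& i <= t, t < l & (t == i) || (t0 < b t)]%N.
have exP : exists t, P t by exists i; rewrite /P leqnn ltn_ord eqxx.
have ubP t : P t -> (t <= l)%N by case/and3P=> _ /ltnW.
case: (ex_maxnP exP ubP) => k /and3P[le_ik lt_kl k_i] max_k.
have b_gt t : (k < t < l)%N -> (b t < t0)%N.
  move=> /andP[lt_kt lt_tl];
    have lt_it : (i < t)%N by apply: leq_ltn_trans lt_kt.
  rewrite ltn_neqAle; apply/andP; split; last first.
    rewrite leqNgt; apply: contraL lt_kt => lt_t0; rewrite -leqNgt;
      apply: max_k.
    by rewrite /P (ltnW lt_it) lt_tl lt_t0 orbT.
  apply/eqP=> e; suff e' : Ordinal lt_tl = i.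
    by have /= e2 := congr1 val e'; rewrite e2 ltnn in lt_it.
  apply: inj_low; rewrite !lowE eqxx muln1 -[RHS]/t0 -e.
  by rewrite (_ : (_ == i) = false) ?muln0 ?subn0 // -val_eqE gtn_eqF.
have [lt_il e0] : (i < l)%N /\ t0 = (b i - r)%N by [].
pose j := (t0 - (l - k.+1))%N.
have [le_t0 le_j] : (l - k.+1 <= t0)%N /\ (nth 0 a k.+1 <= j)%N.
  have [lt_k1|ge_k1] := ltnP k.+1 l.
    by have := b_gt k.+1; rewrite lt_k1 ltnSn /b /j => /(_ isT); lia.
  by rewrite (nth_default 0 (leq_trans le_l ge_k1)); lia.
have lt_j : (j < nth 0 a k)%N.
  case/orP: k_i => [/eqP e | ]; last by rewrite /b /j; lia.
  by move: le_t0 le_r; rewrite /j /t0 e /b; lia.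
have le_aki := nth_partition_le part_a le_ik.
have len : hook_length a (val i, j) = r.
  rewrite (hook_lengthE part_a le_ik le_j lt_j).
  by move: le_t0 le_r lt_j; rewrite /j /t0 /b; lia.
pose g := remove_hook a (val i, j).
have size_g : (size g <= l)%N := leq_trans (size_remove_hook a i j) le_l.
(* The row where the coordinate of row t goes. *)
pose sg t := if t == i :> nat then k else if (i < t <= k)%N then t.-1 else t.
have lt_sg (t : 'I_l) : (sg t < l)%N.
  by have := ltn_ord t; rewrite /sg; case: eqP => //; case: ifP => //; lia.
have sg_inj : injective (fun t => Ordinal (lt_sg t)).
  move=> t t' [] eq_s; apply: val_inj => /=; move: eq_s; rewrite /sg.
  by do 2 case: eqP => ?; do 2? case: ifP => ?; lia.
have low_g : lower (beta_vector l a) i r =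
  permute (beta_vector l g) (perm sg_inj).
  apply/vecP=> t; rewrite lowE !ffunE permE /= /g (nth_remove_hook i j part_a)
    /sg -val_eqE /=.
  have lt_tl := ltn_ord t.
  have [e|t_i] := eqVneq (t : nat) (i : nat).
    by rewrite (removed_row_eq le_ik le_j lt_j) muln1 e -/t0 /j; lia.
  rewrite muln0 subn0; case: ifPn => [/andP[lt_it le_tk]|out_t].
    rewrite (removed_row_lt part_a lt_j) ?prednK; try lia.
    have := nth_partition_le part_a le_tk; rewrite /b; lia.
  have [lt_ti|lt_kt] : (t < i)%N \/ (k < t)%N by lia.
    by rewrite /removed_row lt_ti /b.
  by rewrite (removed_row_gt part_a le_ik le_j).
exists (val i, j); split=> //; first exact: (hook_node part_a le_ik lt_j).
  have := remove_hook_shape i j part_a; rewrite -/g; congr is_partition.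
  have := sum_beta_vector le_l; have := sum_beta_vector size_g.
  have le_r' : (r <= beta_vector l a i)%N by rewrite vE.
  have := sum_lower le_r'; rewrite low_g sum_permute.
  have /and3P[_ _ /eqP <-] := part_a.
  move=> e1 e2 e3; rewrite -e1 e2 in e3; lia.
by exists (perm sg_inj).
Qed.

(** The consequence of the Murnaghan-Nakayama rule that is needed: if every
sequence of removals of hooks of lengths b leads to a partition whose value at
b' is zero, then so is the value of a at b ++ b'.  The signs play no role. *)
Lemma char_value_removal l n a b b' :
    is_partition n a -> (size a <= l)%N -> 0%N \notin b ->
    (forall xs, removal_seq a b xs ->
       is_partition (n - sumn b) (removal_result a xs) ->
       (size (removal_result a xs) <= l)%N ->
     char_value (beta_vector l (removal_result a xs)) b' = 0) ->
  char_value (beta_vector l a) (b ++ b') = 0.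
Proof.
elim: b n a => [|r b IH] n a part_a le_l.
  by move=> _ /(_ [::]); rewrite subn0; apply.
rewrite inE negb_or => /andP[r0 b0] vanish /=; apply: big1 => i le_r.
case: (boolP (injectiveb (lower (beta_vector l a) i r))); last first.
  by move/injectiveP; apply: char_value_eq0.
move/injectiveP=> inj_low.
have [|x [in_x len_x part_x le_x [s ->]]] :=
    lower_beta_vector part_a le_l _ le_r inj_low.
  by rewrite lt0n eq_sym.
rewrite char_value_permute (IH _ _ part_x) ?mulr0 // => xs rem_xs part_xs le_xs.
apply: (vanish (x :: xs)) => //=; first by rewrite in_x len_x eqxx.
by rewrite subnDA.
Qed.

(** * Cycle types *)
Section BlockColorings.
Variable K : finType.
Implicit Types (v u : {ffun K -> nat}).

(** The number of ways to distribute blocks of sizes b among the colours so that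
colour k receives v k - u k points in all. *)
Fixpoint num_distr v u (b : seq nat) : nat :=
  if b is r :: b' then (\sum_(i | r <= v i) num_distr (lower v i r) u b')%N
  else (v == u).

(** The total size of the blocks to which t gives the colour k. *)
Definition weight b (t : (size b).-tuple K) k :=
  (\sum_(j < size b) nth 0 b j * (tnth t j == k))%N.

Lemma num_distrE v u b :
  num_distr v u b =
  (\sum_(t : (size b).-tuple K) [forall k, weight t k + u k == v k])%N.
Proof.
elim: b v => [|r b IH] v /=.
  rewrite (bigD1 [tuple]) //= [X in (_ + X)%N]big1 ?addn0; last first.
    by move=> t /negP[]; apply/eqP; apply: tuple0.
  congr nat_of_bool; apply/eqP/forallP=> [-> k | eq_uv].
    by rewrite /weight big_ord0.
  by apply/vecP=> k; rewrite -(eqP (eq_uv k)) /weight big_ord0.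
pose h (p : K * (size b).-tuple K) : (size (r :: b)).-tuple K :=
  [tuple of p.1 :: p.2].
rewrite [RHS](reindex h) /=; last first.
  exists (fun t => (thead t, [tuple of behead t])) => [[i t] _ | t _] /=.
    by rewrite /h /= theadE; congr (_, _); apply: val_inj.
  by rewrite /h /= -tuple_eta.
rewrite -(pair_bigA _ (fun i t =>
  nat_of_bool [forall k, weight (h (i, t)) k + u k == v k]))%N /=.
rewrite [LHS]big_mkcond; apply: eq_bigr => i _ /=.
have wE t k : weight (h (i, t)) k = (r * (i == k) + weight t k)%N.
  rewrite /weight /= big_ord_recl tnth0 /=; congr (_ + _)%N.
  by apply: eq_bigr => j _; rewrite tnthS.
case: leqP => [le_r | lt_r].
  rewrite IH; apply: eq_bigr => t _; congr nat_of_bool; apply: eq_forallb => k.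
  rewrite wE ffunE [k == i]eq_sym; have [<-|_] := eqVneq i k;
    last by rewrite !muln0 subn0.
  by rewrite muln1 -addnA -(eqn_add2l r) subnKC.
rewrite big1 // => t _; apply/eqP; rewrite eqb0; apply/negP=> /forallP/(_ i).
by rewrite wE eqxx muln1 -addnA; apply/negP;
  rewrite neq_ltn (leq_trans lt_r) ?leq_addr // orbT.
Qed.
End BlockColorings.

Lemma char_value_num_distr l (v : {ffun 'I_l -> nat}) b :
  char_value v b =
  \sum_(w : 'S_l) (-1) ^+ w * (num_distr v (permute (staircase l) w) b)%:R.
Proof.
elim: b v => [//|r b IH] v /=; under eq_bigr do rewrite IH.
rewrite exchange_big; apply: eq_bigr => w _ /=.
by rewrite natr_sum mulr_sumr.
Qed.

Section CycleType.
Variables (n : nat) (g : 'S_n) (K : finType).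

(* The cycles of g, in the order in which cycle_type lists their sizes. *)
Let orbits := sort (relpre (fun X : {set 'I_n} => #|X|) geq) (enum (porbits g)).

Let cycle_typeE : cycle_type g = [seq #|X| | X : {set 'I_n} <- orbits].
Proof. by rewrite /cycle_type sort_map. Qed.

(** A colouring fixed by g amounts to a colour for each cycle of g. *)
Lemma num_fixedE (v u : {ffun K -> nat}) :
  num_fixed v u g = num_distr v u (cycle_type g).
Proof.
rewrite cycle_typeE num_distrE; set b := map _ _.
have size_b : size b = size orbits by rewrite size_map.
have uniq_orb : uniq orbits by rewrite sort_uniq enum_uniq.
have mem_orb X : (X \in orbits) = (X \in porbits g)
  by rewrite mem_sort mem_enum.
have lt_idx x : (index (porbit g x) orbits < size b)%N.
  by rewrite size_b index_mem mem_orb imset_f.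
pose idx x := Ordinal (lt_idx x).
have nth_idx x : nth set0 orbits (idx x) = porbit g x.
  by rewrite nth_index // mem_orb imset_f.
have idxP x (j : 'I_(size b)) : (idx x == j) = (x \in nth set0 orbits j).
  have lt_j : (j < size orbits)%N by rewrite -size_b.
  have := mem_nth set0 lt_j; rewrite mem_orb => /imsetP[y _ orb_j].
  rewrite -val_eqE /= orb_j; apply/eqP/idP=> [e | ].
    by rewrite -orb_j -e nth_idx porbit_id.
  by rewrite -eq_porbit_mem => /eqP e; rewrite e -orb_j index_uniq.
have ex_idx j : exists x, idx x == j.
  have lt_j : (j < size orbits)%N by rewrite -size_b.
  have := mem_nth set0 lt_j; rewrite mem_orb => /imsetP[y _ orb_j].
  by exists y; rewrite idxP orb_j porbit_id.
pose h (t : (size b).-tuple K) : {ffun 'I_n -> K} := [ffun x => tnth t (idx x)].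
have h_inj : injective h.
  move=> t t' eq_h; apply: eq_from_tnth => j; have [x /eqP <-] := ex_idx j.
  by have /ffunP/(_ x) := eq_h; rewrite !ffunE.
have h_im : h @: setT = [set c | fixes g c].
  apply/setP=> c; rewrite inE; apply/imsetP/forallP=> [[t _ ->] x | fix_c].
    rewrite !ffunE; suff -> : idx (g x) = idx x by [].
    by apply/eqP; rewrite idxP nth_idx; apply: (mem_porbit g 1).
  exists [tuple c (xchoose (ex_idx j)) | j < size b] => //; apply/ffunP=> x.
  rewrite ffunE tnth_mktuple; have := xchooseP (ex_idx (idx x)).
  rewrite idxP nth_idx => /porbitP[m ->].
  by elim: m => [|m IHm]; rewrite ?perm1 // expgSr permM (eqP (fix_c _)).
have contentE t k : content (h t) k = weight t k.
  rewrite ffunE -sum1_card (partition_big idx predT) //=.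
  apply: eq_bigr => j _;
    rewrite (nth_map set0) -?size_b // -sum1_card big_distrl /=.
  rewrite [RHS]big_mkcond [LHS]big_mkcond; apply: eq_bigr => x _.
  rewrite -idxP inE ffunE; case: (idx x =P j) => [->|_];
    rewrite ?andbF ?andbT //.
  by rewrite mul1n; case: (_ == _).
rewrite /num_fixed big_mkcond /=.
transitivity (\sum_(c in [set c | fixes g c]) extends v u c)%N.
  rewrite [RHS]big_mkcond; apply: eq_bigr => c _; rewrite inE.
  by case: extends; case: fixes.
rewrite -h_im big_imset /=; last by move=> t t' _ _; apply: h_inj.
apply: eq_big => [t|t _]; first by rewrite inE.
by congr nat_of_bool; apply: eq_forallb => k; rewrite contentE.
Qed.
End CycleType.

(** The formula of Frobenius, in terms of colourings. *)
Lemma char_value_cycle_type l (v : {ffun 'I_l -> nat}) n (g : 'S_n) :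
  char_value v (cycle_type g) =
  \sum_(w : 'S_l) (-1) ^+ w * (num_fixed v (permute (staircase l) w) g)%:R.
Proof.
by rewrite char_value_num_distr; apply: eq_bigr => w _; rewrite num_fixedE.
Qed.

Lemma reshape_index_cons r a i :
  reshape_index (r :: a) i =
    if (i < r)%N then 0%N else (reshape_index a (i - r)).+1.
Proof.
by rewrite /reshape_index /= subn_eq0; case: ltnP => // le_r; rewrite subSn.
Qed.

Lemma count_reshape_index a k :
  count (fun i => reshape_index a i == k) (iota 0 (sumn a)) = nth 0%N a k.
Proof.
elim: a k => [|r a IH] k /=; first by rewrite nth_nil.
rewrite iotaD count_cat add0n -[X in iota X (sumn a)]addn0 iotaDl count_map.
rewrite (eq_in_count (a2 := fun=> 0%N == k)); last first.
  by move=> i; rewrite mem_iota add0n reshape_index_cons => /= ->.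
rewrite (eq_in_count (a1 := preim (addn r) (fun i => reshape_index (r :: a) i
  == k)) (a2 := fun i => (reshape_index a i).+1 == k)); last first.
  by move=> i _; rewrite /= reshape_index_cons ltnNge leq_addr addKn.
case: k => [|k] /=; last by rewrite count_pred0 IH.
by rewrite count_predT size_iota (eq_count (a2 := pred0)) // count_pred0 addn0.
Qed.

Lemma card_reshape_index n a k : sumn a = n ->
  #|[set x : 'I_n | reshape_index a x == k]| = nth 0%N a k.
Proof.
move=> <-; rewrite -count_reshape_index count_iota -sum1_card big_mkcond.
by apply: eq_bigr => x _; rewrite inE; case: (_ == _).
Qed.

(** The permutation that rotates each of the consecutive blocks of sizes b. *)
Lemma ex_cycle_type n b : is_partition n b -> exists g : 'S_n, cycle_type g = b.
Proof.
case/and3P=> sorted_b b0 /eqP sum_b.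
pose blk k : {set 'I_n} := [set x : 'I_n | reshape_index b x == k].
pose B (x : 'I_n) := enum (blk (reshape_index b x)).
pose f x := next (B x) x.
have memB x y : (y \in B x) = (reshape_index b y == reshape_index b x).
  by rewrite mem_enum inE.
have f_blk x : reshape_index b (f x) = reshape_index b x.
  by apply/eqP; rewrite -memB mem_next memB.
have f_inj : injective f.
  move=> x y eq_f; have eq_B : B x = B y by rewrite /B -f_blk eq_f f_blk.
  by move: eq_f; rewrite /f eq_B; move/(can_inj (prev_next (enum_uniq _))).
pose g := perm f_inj; exists g.
have gX_blk m x : reshape_index b ((g ^+ m)%g x) = reshape_index b x.
  elim: m => [|m IH]; first by rewrite perm1.
  by rewrite expgSr permM [in LHS]permE f_blk.
have orbE x : porbit g x = blk (reshape_index b x).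
  apply/setP=> y; rewrite inE; apply/porbitP/eqP=> [[m ->]//|eq_y].
  have yB : y \in B x by rewrite memB eq_y.
  have xB : x \in B x by rewrite memB.
  have conn : fconnect (next (B x)) x y.
    by rewrite (fconnect_cycle (cycle_next (enum_uniq _)) xB).
  exists (findex (next (B x)) x y); rewrite -[LHS](iter_findex conn).
  elim: (findex _ _ _) => [|m IH]; first by rewrite perm1.
  by rewrite iterS IH expgSr permM permE /f /B gX_blk.
have card_blk k : #|blk k| = nth 0%N b k by apply: card_reshape_index.
have perm_orb : perm_eq (enum (porbits g)) [seq blk k | k <- iota 0 (size b)].
  apply: uniq_perm; first exact: enum_uniq.
    rewrite map_inj_in_uniq ?iota_uniq // => k k'.
    rewrite !mem_iota !add0n /= => lt_k _ eq_blk.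
    have : (0 < #|blk k|)%N.
      by rewrite card_blk lt0n; apply: contraNneq b0 => <-; apply: mem_nth.
    case/card_gt0P=> x xk; have := xk; rewrite eq_blk; move: xk; rewrite !inE.
    by move=> /eqP-> /eqP.
  move=> X; rewrite mem_enum; apply/imsetP/mapP=> [[x _ ->] | [k]].
    exists (reshape_index b x); last exact: orbE.
    rewrite mem_iota add0n /= ltnNge; apply/negP => /(nth_default 0%N).
    by rewrite -card_blk => /eqP; rewrite cards_eq0 => /eqP/setP/(_ x);
      rewrite !inE eqxx.
  rewrite mem_iota add0n /= => lt_k ->; have : (0 < #|blk k|)%N.
    by rewrite card_blk lt0n; apply: contraNneq b0 => <-; apply: mem_nth.
  by case/card_gt0P=> x; rewrite inE => /eqP xk; exists x => //;
    rewrite orbE xk.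
have tr : transitive geq by move=> x y z /=; lia.
have asym : antisymmetric geq by move=> x y /=; lia.
have tot : total geq by move=> x y /=; lia.
apply: (sorted_eq tr asym) => //; first exact: sort_sorted.
rewrite perm_sort (perm_trans (perm_map _ perm_orb)) // -map_comp.
rewrite (eq_map (g := nth 0%N b)); last exact: card_blk.
by rewrite map_nth_iota0 // take_size.
Qed.

(** * Permutation characters and determinantal characters *)
Section Stabilizer.
Variables (n : nat) (K : finType).
Implicit Types (c : {ffun 'I_n -> K}) (v u a b : {ffun K -> nat}).

(** The permutations preserving the colouring c. *)
Definition stabilizer c : {set 'S_n} := [set g | fixes g c].

Fact stabilizer_group_set c : group_set (stabilizer c).
Proof.
apply/group_setP; split=> [|g h].
  by rewrite inE; apply/forallP=> x; rewrite perm1.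
rewrite !inE !fixesE => /eqP fg /eqP fh; by rewrite -recolorM -fh -fg.
Qed.

Canonical stabilizer_group c := Group (stabilizer_group_set c).

Lemma recolor_inj y : injective (fun c => recolor c y).
Proof.
apply: (can_inj (g := fun c => recolor c y^-1%g)) => c.
by rewrite recolorM mulVg; apply/ffunP=> x; rewrite ffunE perm1.
Qed.

Lemma extends_content v u c c' :
  extends v u c -> extends v u c' = (content c' == content c).
Proof.
move=> /forallP ext_c; apply/forallP/eqP=> [ext_c' | -> //].
by apply/vecP=> k; apply/(@addIn (u k));
  rewrite (eqP (ext_c k)) (eqP (ext_c' k)).
Qed.

(** Stated for any subgroup with the same elements as the stabiliser of c, so as
to cover the Young subgroups as well. *)
Lemma cfInd1_stabilizer (H : {group 'S_n}) c v u :
    (forall h, (h \in H) = fixes h c) -> extends v u c ->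
  forall g, 'Ind[[set: 'S_n], H] 1 g = (num_fixed v u g)%:R.
Proof.
move=> memH ext_c g; rewrite cfIndE ?subsetT //.
have -> : \sum_(y in [set: 'S_n]) (1 : 'CF(H)) (g ^ y)%g =
    (\sum_(y : 'S_n) fixes g (recolor c y))%N%:R :> algC.
  rewrite natr_sum; apply: eq_big => y; first by rewrite inE.
  move=> _; rewrite cfun1E memH; congr (nat_of_bool _)%:R.
  apply/forallP/forallP=> fix_c x.
    by have := fix_c (y x); rewrite conjgE !permM permK !ffunE.
  have := fix_c (y^-1 x)%g; rewrite !ffunE permKV => /eqP <-.
  by rewrite conjgE !permM.
have cardH c' : content c' == content c ->
    (\sum_y (recolor c y == c') = #|H|)%N.
  move/eqP/esym/eq_contentP => [y0 ->].
  rewrite (reindex_inj (mulgI y0)) /= -sum1_card [RHS]big_mkcond.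
  apply: eq_bigr => h _; rewrite memH fixesE -recolorM.
  by rewrite (inj_eq (@recolor_inj y0)) eq_sym; case: eqP.
have -> : (\sum_(y : 'S_n) fixes g (recolor c y) = #|H| * num_fixed v u g)%N.
  rewrite (partition_big (recolor c) (extends v u)) /=; last first.
    by move=> y _; rewrite (extends_content _ ext_c) content_recolor.
  rewrite big_distrr /=; apply: eq_bigr => c' ext_c'.
  rewrite (extends_content _ ext_c) in ext_c'.
  rewrite -(cardH c' ext_c') big_distrl [LHS]big_mkcond.
  by apply: eq_bigr => y _ /=; case: eqP => [->|_]; rewrite ?mul1n.
by rewrite natrM mulKf // pnatr_eq0 -lt0n cardG_gt0.
Qed.

(** The permutation character of S_n on the colourings with content v - u; it is
zero if there are none. *)
Definition coloring_char v u : 'CF([set: 'S_n]) :=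
  if [pick c | extends v u c] is Some c then 'Ind[[set: 'S_n], stabilizer c] 1
  else 0.

Lemma coloring_charE v u g : coloring_char v u g = (num_fixed v u g)%:R.
Proof.
rewrite /coloring_char; case: pickP => [c ext_c | no_c].
  by apply: (cfInd1_stabilizer _ ext_c) => h; rewrite inE.
by rewrite cfunE /num_fixed big_pred0.
Qed.

Lemma coloring_char_char v u : coloring_char v u \is a character.
Proof.
rewrite /coloring_char; case: pickP => [c _ | _]; last exact: rpred0.
exact/cfInd_char/cfun1_char.
Qed.

Lemma cfdot_coloring_char N v a u b :
    (forall i, v i <= N)%N -> (\sum_i v i = n + \sum_i a i)%N ->
  '[coloring_char v a, coloring_char u b] = (num_matrices N v a u b)%:R.
Proof.
move=> le_vN sum_v; rewrite cfdotE cardsT.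
have -> :
    \sum_(g in [set: 'S_n]) coloring_char v a g * (coloring_char u b g)^* =
    (n`! * num_matrices N v a u b)%N%:R :> algC.
  rewrite -(sum_num_fixed _ _ le_vN sum_v) natr_sum; apply: eq_big => g;
    first by rewrite inE.
  by move=> _; rewrite !coloring_charE natrM rmorph_nat.
by rewrite card_Sn natrM mulKf // pnatr_eq0 -lt0n fact_gt0.
Qed.

End Stabilizer.

Section Determinantal.
Variables (n l : nat).
Implicit Types (v : {ffun 'I_l -> nat}).
Let d := staircase l.

(** For v = alpha + delta, the expansion of the determinant which expresses
chi^alpha in terms of characters induced from Young subgroups. *)
Definition determinantal_char v : 'CF([set: 'S_n]) :=
  \sum_(w : 'S_l) (-1) ^+ w *: coloring_char n v (permute d w).

Lemma determinantal_charE v g :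
  determinantal_char v g = char_value v (cycle_type g).
Proof.
rewrite char_value_cycle_type sum_cfunE; apply: eq_bigr => w _.
by rewrite cfunE coloring_charE.
Qed.

Lemma determinantal_char_vchar v :
  determinantal_char v \in 'Z[irr [set: 'S_n]]%g.
Proof.
apply: rpred_sum => w _; rewrite rpredZsign.
exact/char_vchar/coloring_char_char.
Qed.

Lemma determinantal_char_norm v :
    injective v -> (\sum_i v i = n + \sum_i d i)%N ->
  '[determinantal_char v] = 1.
Proof.
move=> inj_v sum_v; pose N := (\sum_i v i)%N.
have le_vN i : (v i <= N)%N by rewrite /N (bigD1 i) //= leq_addr.
rewrite -(alternant_id inj_v) -(alternating_matricesE le_vN) //.
rewrite cfdot_suml; apply: eq_bigr => w _.
rewrite cfdot_sumr; apply: eq_bigr => w' _.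
rewrite cfdotZl cfdotZr rmorph_sign (cfdot_coloring_char _ _ le_vN) //.
by rewrite sum_permute.
Qed.
End Determinantal.

(** * The irreducible character labelled by a partition *)
Section ConjugateShape.
Variables (n l : nat) (a : seq nat).
Hypotheses (part_a : is_partition n a) (le_l : (size a <= l)%N).
Let a' := conj_partition a.
Let L := size a'.
Let v := beta_vector l a.
Let d := staircase l.
(* The contents: v and d are alpha + delta and delta, so that extends v d c says
   that c has content alpha; similarly for v' and zero with the conjugate. *)
Let v' : {ffun 'I_L -> nat} := [ffun j : 'I_L => nth 0%N a' j].
Let zero : {ffun 'I_L -> nat} := [ffun=> 0%N].

Lemma size_conj_partition : size a' = head 0%N a.
Proof. by rewrite size_map size_iota. Qed.

Lemma nth_conj_partition j : nth 0%N a' j = count (fun r => j < r)%N a.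
Proof.
have [lt_j|le_j] := ltnP j L.
  by rewrite /L size_conj_partition in lt_j;
    rewrite (nth_map 0%N) ?size_iota // nth_iota.
rewrite nth_default //; symmetry; apply/eqP; rewrite -leqn0 leqNgt -has_count.
apply/hasPn=> r /(nthP 0%N)[i _ <-]; rewrite -leqNgt.
by apply: leq_trans (nth_partition_le part_a (leq0n i)) _;
  rewrite nth0 -size_conj_partition.
Qed.

Lemma nth_conj_partition_sum j :
  nth 0%N a' j = (\sum_(t < l) (j < nth 0 a t))%N.
Proof.
rewrite nth_conj_partition -sum1_count big_mkcond (big_nth 0%N) big_mkord.
rewrite (big_ord_widen l (fun t => if (j < nth 0 a t)%N then 1%N else 0%N)) //.
rewrite big_mkcond /=; apply: eq_bigr => t _.
by case: (ltnP t) => [_|/(nth_default 0%N)->]; first case: ltnP.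
Qed.

Lemma nth_le_size_conj t : (nth 0 a t <= L)%N.
Proof. by rewrite /L size_conj_partition -nth0 (nth_partition_le part_a). Qed.

Lemma sumn_conj_partition : sumn a' = n.
Proof.
rewrite (sumn_nth (leqnn L)); under eq_bigr do rewrite nth_conj_partition_sum.
rewrite exchange_big /=; case/and3P: part_a => _ _ /eqP <-;
  rewrite (sumn_nth le_l).
by apply: eq_bigr => t _; rewrite sum_ord_lt; apply/minn_idPr/nth_le_size_conj.
Qed.

Lemma extends_zero (e : {ffun 'I_n -> 'I_L}) :
  extends v' zero e -> forall j, content e j = nth 0%N a' j.
Proof.
by move=> /forallP ext j; have := ext j; rewrite !ffunE addn0 => /eqP.
Qed.

(** Number the nodes of the diagram, and colour each one by its row and by its
column. *)
Lemma ex_jointly_injective :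
  exists (c : {ffun 'I_n -> 'I_l}) (e : {ffun 'I_n -> 'I_L}),
  [/\ extends v d c, extends v' zero e & jointly_injective c e].
Proof.
pose D := diagram a; pose y x := nth (0%N, 0%N) D x.
have size_D : size D = n.
  rewrite -(count_predT D) count_diagram; case/and3P: part_a => _ _ /eqP <-.
  rewrite (sumn_nth (leqnn (size a))); apply: eq_bigr => i _.
  by rewrite /= sum1_card card_ord.
have inD (x : 'I_n) : ((y x).2 < nth 0 a (y x).1)%N.
  by rewrite -mem_diagram -surjective_pairing mem_nth ?size_D.
have lt1 (x : 'I_n) : ((y x).1 < l)%N.
  exact: leq_trans (nth_gt0_size (inD x)) le_l.
have lt2 (x : 'I_n) : ((y x).2 < L)%N
  by apply: leq_trans (inD x) (nth_le_size_conj _).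
have card_y P : #|[set x : 'I_n | P (y x)]| = count P D.
  rewrite -sum1_count big_mkcond (big_nth (0%N, 0%N)) big_mkord.
  rewrite size_D -sum1_card big_mkcond.
  by apply: eq_bigr => x _; rewrite inE.
exists [ffun x => Ordinal (lt1 x)], [ffun x => Ordinal (lt2 x)]; split.
- apply/forallP=> t; rewrite !ffunE eqn_add2r; apply/eqP.
  transitivity #|[set x : 'I_n | (y x).1 == t]|.
    by apply: eq_card => x; rewrite !inE ffunE.
  rewrite (card_y (fun p => p.1 == t)) count_diagram /=.
  have [lt_t|le_t] := ltnP t (size a).
    rewrite (bigD1 (Ordinal lt_t)) //= eqxx sum1_card card_ord big1 ?addn0 //
      => i.
    by rewrite -val_eqE /= => /negPf neq; rewrite big1 // => j _; rewrite neq.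
  rewrite nth_default // big1 // => i _; rewrite big1 // => j _.
  by rewrite ltn_eqF // (leq_trans (ltn_ord i)).
- apply/forallP=> j; rewrite !ffunE addn0; apply/eqP.
  transitivity #|[set x : 'I_n | (y x).2 == j]|.
    by apply: eq_card => x; rewrite !inE ffunE.
  rewrite (card_y (fun p => p.2 == j)) count_diagram /= nth_conj_partition.
  rewrite -sum1_count [RHS]big_mkcond (big_nth 0%N) big_mkord;
    apply: eq_bigr => i _.
  case: ltnP => [lt_j | le_j].
    rewrite (bigD1 (Ordinal lt_j)) //= eqxx big1 ?addn0 // => u.
    by rewrite -val_eqE /= => /negPf->.
  by rewrite big1 // => u _; rewrite ltn_eqF // (leq_trans (ltn_ord u)).
apply/injectiveP=> x x'; rewrite !ffunE => -[e1 e2]; apply/val_inj/eqP => /=.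
rewrite -(nth_uniq (0%N, 0%N) _ _ (_ : uniq D)) ?size_D //.
  by rewrite [nth _ _ _]surjective_pairing [X in _ == X]surjective_pairing /=
    e1 e2.
apply: allpairs_uniq_dep => [|i _|]; [exact: iota_uniq | exact: iota_uniq |].
by move=> [i j] [i' j'] _ _ /= [-> ->].
Qed.

(** For w <> 1, let k be the first index moved by w; then w k > k, so that
content v - delta o w gives more than alpha_0 + ... + alpha_k points to the
colours 0, ..., k.  In a 0-1 matrix whose column sums are the conjugate of
alpha, column j has at most min(k + 1, alpha'_j) entries in these rows, and
these bounds add up to alpha_0 + ... + alpha_k. *)
Lemma not_jointly_injective (w : 'S_l)
    (c : {ffun 'I_n -> 'I_l}) (e : {ffun 'I_n -> 'I_L}) :
    w != 1%g -> extends v (permute d w) c -> extends v' zero e ->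
  ~~ jointly_injective c e.
Proof.
move=> neq_w1 /forallP ext_c ext_e; apply/negP=> /injectiveP inj_ce.
have [i0 moves_i0] : exists i0, w i0 != i0.
  apply/existsP; apply: contraNT neq_w1; rewrite negb_exists => /forallP fix_w.
  by apply/eqP/permP=> i; rewrite perm1; apply/eqP; have := fix_w i;
    rewrite negbK.
case: (@arg_minnP _ i0 (fun i => w i != i) val moves_i0) => k moves_k min_k.
have fix_lt (i : 'I_l) : (i < k)%N -> w i = i.
  by move=> lt_ik; apply/eqP; apply: contraTT lt_ik => /min_k; rewrite -leqNgt.
have lt_k : (k < w k)%N.
  rewrite ltn_neqAle eq_sym val_eqE moves_k /= leqNgt; apply/negP=> lt_wk.
  by case/eqP: moves_k; apply: (@perm_inj _ w); apply: fix_lt.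
have content_lt (t : 'I_l) : (t < k)%N -> content c t = nth 0%N a t.
  move=> lt_tk; have := ext_c t; rewrite !ffunE (fix_lt t) // eqn_add2r.
  by move/eqP.
have content_k : (nth 0 a k < content c k)%N.
  have /eqP := ext_c k; rewrite [v k]ffunE [permute _ _ _]ffunE ![d _]ffunE /=.
  have lt_wk := ltn_ord (w k); move=> e_k.
  rewrite -(ltn_add2r (l - (w k).+1)) e_k ltn_add2l; apply: ltn_sub2l => //.
  exact: leq_ltn_trans lt_k lt_wk.
pose X := [set x | c x <= k]%N.
have cardX : #|X| = (\sum_(t < l | t <= k) content c t)%N.
  rewrite -sum1_card (partition_big c (fun t : 'I_l => t <= k)%N) /=;
    last by move=> x; rewrite inE.
  apply: eq_bigr => t le_t; rewrite ffunE -sum1_card; apply: eq_bigl => x.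
  by rewrite !inE; case: eqP => [->|_]; rewrite ?andbT ?andbF.
have gtX : (\sum_(t < l | t <= k) nth 0 a t < #|X|)%N.
  rewrite cardX (bigD1 k) //= [X in (_ < X)%N](bigD1 k) //= -addSn;
    apply: leq_add => //.
  apply: leq_sum => t /andP[le_tk neq_tk]; rewrite content_lt //.
  by rewrite ltn_neqAle val_eqE neq_tk.
suff : (#|X| <= \sum_(t < l | t <= k) nth 0 a t)%N by rewrite leqNgt gtX.
rewrite -sum1_card (partition_big e predT) //=.
apply: (@leq_trans (\sum_(j < L) \sum_(t < l | t <= k) (j < nth 0 a t)))%N;
  last first.
  rewrite exchange_big; apply: leq_sum => t _ /=; rewrite sum_ord_lt;
    exact: geq_minr.
apply: leq_sum => j _; rewrite sum1_card.
have [lt_jk|le_kj] := ltnP j (nth 0 a k).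
  have -> : (\sum_(t < l | t <= k) (j < nth 0 a t) = \sum_(t < l | t <= k) 1)%N.
    apply: eq_bigr => t le_tk;
      by rewrite (leq_trans lt_jk (nth_partition_le part_a le_tk)).
  rewrite sum1_card -cardsE -(card_in_imset (f := c)); last first.
    move=> x x'; rewrite !inE /= => /andP[_ /eqP ex] /andP[_ /eqP ex'] eq_c.
    by apply: inj_ce; rewrite !ffunE eq_c ex ex'.
  apply: subset_leq_card; apply/subsetP=> t /imsetP[x + ->].
  by rewrite !inE => /andP[le_x _]; move: le_x; rewrite inE.
apply: (@leq_trans (content e j)).
  rewrite -cardsE [content e j]ffunE; apply: subset_leq_card.
  by apply/subsetP=> x; rewrite !inE => /andP[].
rewrite (extends_zero ext_e) nth_conj_partition_sum [X in (_ <= X)%N]big_mkcond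
  /=.
apply: leq_sum => t _;
  case: (leqP t k) => // /ltnW/(nth_partition_le part_a) le_t.
by rewrite ltnNge (leq_trans le_t le_kj).
Qed.

(* The induced sign character of the Young subgroup of the conjugate. *)
Let E := 'Ind[[set: 'S_n], young_subgroup n a']
           ('Res[young_subgroup n a'] (sign_char n)).

Lemma sign_charE g : sign_char n g = (-1) ^+ g.
Proof. by rewrite cfunE inE mulr1n mxtrace_scalar. Qed.

(** The Young subgroup of b is the stabiliser of the colouring by blocks. *)
Lemma young_char (K : nat) (b : seq nat) (x y : {ffun 'I_K -> nat}) :
    sumn b = n -> (size b <= K)%N ->
    (forall t : 'I_K, nth 0 b t + y t = x t)%N ->
  forall g, 'Ind[[set: 'S_n], young_subgroup n b] 1 g = (num_fixed x y g)%:R.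
Proof.
move=> sum_b le_K ext.
have lt_K (z : 'I_n) : (reshape_index b z < K)%N.
  by apply: leq_trans le_K; apply: reshape_indexP; rewrite sum_b.
apply: (@cfInd1_stabilizer _ _ _ [ffun z => Ordinal (lt_K z)]).
  by move=> h; rewrite inE; apply: eq_forallb => z; rewrite !ffunE -val_eqE.
apply/forallP=> t; rewrite -ext ffunE eqn_add2r -(card_reshape_index _ sum_b).
by apply/eqP/eq_card => z; rewrite !inE ffunE -val_eqE.
Qed.

Lemma sign_young_charE g : E g = (-1) ^+ g * (num_fixed v' zero g)%:R.
Proof.
rewrite /E -['Res[_] _]mul1r cfIndM ?subsetT // cfunE sign_charE mulrC.
congr (_ * _); apply: young_char; rewrite ?sumn_conj_partition // => t.
by rewrite !ffunE addn0.
Qed.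

Lemma cfdot_sign_young w :
  '[coloring_char n v (permute d w), E] =
   #|[set: 'S_n]|%:R^-1 *
     \sum_(c : {ffun 'I_n -> 'I_l} | extends v (permute d w) c)
       \sum_(e : {ffun 'I_n -> 'I_L} | extends v' zero e)
         (jointly_injective c e)%:R.
Proof.
rewrite cfdotE -sum_sign_num_fixed; congr (_ * _).
apply: eq_big => g; first by rewrite inE.
by move=> _; rewrite coloring_charE sign_young_charE rmorphM rmorph_sign
  rmorph_nat mulrCA.
Qed.

Lemma cfdot_sign_young_eq0 w : w != 1%g ->
  '[coloring_char n v (permute d w), E] = 0.
Proof.
move=> neq_w1; rewrite cfdot_sign_young big1 ?mulr0 // => c ext_c.
rewrite big1 // => e ext_e; apply/eqP; rewrite pnatr_eq0 eqb0.
exact: not_jointly_injective ext_c ext_e.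
Qed.

Lemma cfdot_sign_young_neq0 : '[coloring_char n v d, E] != 0.
Proof.
rewrite -(permute1 d) cfdot_sign_young mulf_eq0 negb_or invr_eq0 pnatr_eq0
  -lt0n cardG_gt0 /=.
have [c [e [ext_c ext_e inj_ce]]] := ex_jointly_injective.
rewrite permute1 (bigD1 c) //= (bigD1 e) //= inj_ce gt_eqF //.
rewrite ltr_wpDr ?ltr_wpDr ?ltr01 ?sumr_ge0 // => c' _; exact: sumr_ge0.
Qed.

Lemma young_charE :
  'Ind[[set: 'S_n], young_subgroup n a] 1 = coloring_char n v d.
Proof.
apply/cfunP=> g; rewrite coloring_charE; apply: young_char => // [|t].
  by case/and3P: part_a => _ _ /eqP.
by rewrite [v t]ffunE.
Qed.

Lemma sign_young_char_char : E \is a character.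
Proof. exact/cfInd_char/cfRes_char/cfRepr_char. Qed.

(** The default value in the definition of partition_Iirr does not occur, since
the two induced characters are not orthogonal. *)
Lemma partition_Iirr_spec (i := partition_Iirr n a) :
  i \in irr_constt (coloring_char n v d) /\ i \in irr_constt E.
Proof.
rewrite {}/i /partition_Iirr young_charE -/a' -/E;
  case: pickP => [i /andP[] // | no_i].
case/eqP: cfdot_sign_young_neq0; rewrite cfdot_sum_irr big1 // => i _.
have := no_i i; rewrite !irr_consttE; case: eqP => [->|_] /=;
  first by rewrite mul0r.
by move/negbFE/eqP=> ->; rewrite rmorph0 mulr0.
Qed.

(** The terms with w <> 1 are orthogonal to the label, which is a constituent of
E. *)
Lemma partition_char_determinantal :
  partition_char n a = determinantal_char n v.
Proof.
have [iM iE] := partition_Iirr_spec; rewrite /partition_char.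
set i := partition_Iirr n a in iM iE *.
have inj_v : injective v by apply: beta_vector_inj part_a.
have sum_v : (\sum_t v t = n + \sum_t d t)%N.
  by rewrite sum_beta_vector //; case/and3P: part_a => _ _ /eqP->.
have [b [j def_psi]] := vchar_norm1P (determinantal_char_vchar n v)
                                     (determinantal_char_norm inj_v sum_v).
have dot_i : '[determinantal_char n v, 'chi_i] = '[coloring_char n v d, 'chi_i].
  rewrite cfdot_suml (bigD1 1%g) //= big1 ?addr0.
    by rewrite odd_perm1 scale1r permute1.
  move=> w neq_w1; rewrite cfdotZl.
  have [->|i_w] := eqVneq '[coloring_char n v (permute d w), 'chi_i] 0.
    by rewrite mulr0.
  rewrite -irr_consttE in i_w.
  have /eqP := constt_ortho_char (coloring_char_char _ _ _)
    sign_young_char_char i_w iE (cfdot_sign_young_eq0 neq_w1).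
  by rewrite cfdot_irr eqxx oner_eq0.
have : 0 < '[coloring_char n v d, 'chi_i].
  have := Cnat_cfdot_char_irr i (coloring_char_char n v d).
  by move/natr_ge0; rewrite le_eqVlt eq_sym -[_ == 0]negbK -irr_consttE iM.
rewrite -dot_i def_psi cfdotZl cfdot_irr; case: eqP => [->|_];
  last by rewrite mulr0 ltxx.
by case: b {def_psi} => //=; rewrite ?scale1r // mulr1 expr1 ltr0N1.
Qed.

Lemma partition_charE g :
  partition_char n a g = char_value v (cycle_type g).
Proof. by rewrite partition_char_determinantal determinantal_charE. Qed.

End ConjugateShape.

Theorem theorem4p2 (n : nat) (alpha beta : seq nat) (s m p : nat)
    (Halpha : is_partition n alpha) (Hbeta : is_partition n beta)
    (Hs : (1 <= s < size beta)%N) (Hp : prime p)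
    (Hdeg : forall xs : seq (nat * nat),
        removal_seq alpha (take s beta) xs ->
        (p %| partition_char m (removal_result alpha xs) 1%g)%C)
    (Hm : is_partition m (drop s beta)) (Hm1 : (1 < m)%N)
    (Hvan : p_vanishing p m (drop s beta)) :
  forall g : 'S_n, cycle_type g = beta -> partition_char n alpha g = 0%R.
Proof.
move=> g type_g; rewrite (partition_charE Halpha (leqnn _)) type_g
  -(cat_take_drop s beta).
case/and3P: Hbeta => _ beta0 /eqP sum_beta.
case/and3P: (Hm) => _ _ /eqP sum_m.
have sum_s : (n - sumn (take s beta))%N = m.
  by rewrite -sum_beta -[in sumn beta](cat_take_drop s beta) sumn_cat addKn.
apply: (char_value_removal Halpha) => //.
  by apply: contra beta0; apply: mem_take.
move=> xs rem_xs; rewrite sum_s => part_xs size_xs.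
have [h type_h] := ex_cycle_type Hm.
rewrite -type_h -(partition_charE part_xs size_xs).
by apply: Hvan => //; apply: Hdeg.
Qed.
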